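(* There is no categorical metric continuum. That is, for every metric continuum $X$ there is another metric continuum $Y$ such that $X$ and $Y$ have (countable) bases for their closed sets that are elementarily equivalent as lattices, but $X$ and $Y$ are not homeomorphic.
   Context: A continuum is a nonempty compact connected Hausdorff space; a metric continuum is a metrizable one. A base for the closed sets of a compact Hausdorff space $X$ is a family $\mathcal{B}$ of closed sets such that every closed subset of $X$ is an intersection of members of $\mathcal{B}$. Here such bases are lattice bases: they contain $\emptyset$ and $X$ and are closed under finite unions and finite intersections, so that $\mathcal{B}$ is a lattice with operations $\cup$, $\cap$, bottom $0=\emptyset$ and top $1=X$. Two lattices are elementarily equivalent if they satisfy the same first-order sentences in the language of lattices (with $0$ and $1$). Two compact Hausdorff spaces are called elementarily equivalent if they have bases for their closed sets that are elementarily equivalent as lattices. A compact metric space is called categorical if every compact metric space that is elementarily equivalent to it is homeomorphic to it.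
   Formalization: The continuum X is assumed to have more than one point; the one-point continuum is categorical (its only lattice base is {∅, X}), so the claim fails for it. *)

(* Defs.v *)
From HB Require Import structures.
From mathcomp Require Import all_boot all_order all_algebra.
From mathcomp Require Import all_classical all_reals all_analysis.

Set Implicit Arguments.
Unset Strict Implicit.
Unset Printing Implicit Defensive.

Import Order.TTheory GRing.Theory Num.Theory.

Local Open Scope classical_set_scope.

Inductive lat_term : Type :=
  | LVar of nat
  | LBot
  | LTop
  | LMeet of lat_term & lat_term
  | LJoin of lat_term & lat_term.

(* The remaining connectives and the existential quantifier are definable, the
   interpretation being classical.  [LForall i f] binds the variable [LVar i]. *)
Inductive lat_formula : Type :=
  | LEq of lat_term & lat_term
  | LFalse
  | LImp of lat_formula & lat_formula
  | LForall of nat & lat_formula.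

Fixpoint term_vars (t : lat_term) : seq nat :=
  match t with
  | LVar i => [:: i]
  | LBot | LTop => [::]
  | LMeet t1 t2 | LJoin t1 t2 => term_vars t1 ++ term_vars t2
  end.

Fixpoint free_vars (f : lat_formula) : seq nat :=
  match f with
  | LEq t1 t2 => term_vars t1 ++ term_vars t2
  | LFalse => [::]
  | LImp f1 f2 => free_vars f1 ++ free_vars f2
  | LForall i f1 => [seq j <- free_vars f1 | j != i]
  end.

Definition sentence (f : lat_formula) : Prop := free_vars f = [::].

Section Semantics.
Context {d : Order.disp_t} (L : tbLatticeType d).

Fixpoint eval_term (e : nat -> L) (t : lat_term) : L :=
  match t with
  | LVar i => e i
  | LBot => \bot%O
  | LTop => \top%O
  | LMeet t1 t2 => (eval_term e t1 `&` eval_term e t2)%O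
  | LJoin t1 t2 => (eval_term e t1 `|` eval_term e t2)%O
  end.

Fixpoint holds (e : nat -> L) (f : lat_formula) : Prop :=
  match f with
  | LEq t1 t2 => eval_term e t1 = eval_term e t2
  | LFalse => False
  | LImp f1 f2 => holds e f1 -> holds e f2
  | LForall i f1 => forall a : L, holds (fun j => if j == i then a else e j) f1
  end.

(* The truth value of a sentence does not depend on the valuation. *)
Definition satisfies (f : lat_formula) : Prop := forall e : nat -> L, holds e f.

End Semantics.

Definition elementarily_equivalent_lattices {d1 d2 : Order.disp_t}
    (L1 : tbLatticeType d1) (L2 : tbLatticeType d2) : Prop :=
  forall f : lat_formula, sentence f -> (satisfies L1 f <-> satisfies L2 f).

Record closed_base (X : topologicalType) := ClosedBase {
  base_sets :> set (set X);
  base_closed : forall A, base_sets A -> closed A;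
  base_generates : forall F : set X, closed F ->
    exists2 S : set (set X), S `<=` base_sets & F = \bigcap_(A in S) A;
  base_set0 : base_sets set0;
  base_setT : base_sets setT;
  base_setU : forall A B, base_sets A -> base_sets B -> base_sets (A `|` B);
  base_setI : forall A B, base_sets A -> base_sets B -> base_sets (A `&` B)
}.

(* The members of a base, with the bounded lattice structure inherited from
   [set X] (the operations of [set X] being union and intersection). *)
Definition base_lattice (X : topologicalType) (B : closed_base X) : Type :=
  set_type (base_sets B).

Section BaseLattice.
Context (X : topologicalType) (B : closed_base X).

Let S : {pred set X} := fun A => A \in base_sets B.

Let SE A : (A \in S) = base_sets B A :> Prop.
Proof. by rewrite -[LHS]/(is_true (A \in base_sets B)) inE. Qed.

Let meet_closedS : meet_closed S.
Proof. by move=> U V; rewrite !SE; exact: base_setI. Qed.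

Let join_closedS : join_closed S.
Proof. by move=> U V; rewrite !SE; exact: base_setU. Qed.

Let bot_in_S : \bot%O \in S.
Proof. by rewrite SE; exact: base_set0. Qed.

Let top_in_S : \top%O \in S.
Proof. by rewrite SE; exact: base_setT. Qed.

HB.instance Definition _ := SubChoice.on (base_lattice B).
HB.instance Definition _ :=
  Order.SubChoice_isTBSubLattice.Build set_display (set X) _ set_display
    (base_lattice B) meet_closedS join_closedS bot_in_S top_in_S.

Lemma base_lattice_meetE (U V : base_lattice B) :
  val (U `&` V)%O = val U `&` val V.
Proof. by []. Qed.

Lemma base_lattice_joinE (U V : base_lattice B) :
  val (U `|` V)%O = val U `|` val V.
Proof. by []. Qed.

Lemma base_lattice_botE : val (\bot%O : base_lattice B) = set0.
Proof. by []. Qed.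

Lemma base_lattice_topE : val (\top%O : base_lattice B) = setT.
Proof. by []. Qed.

End BaseLattice.

Definition homeomorphic (X Y : topologicalType) : Prop :=
  exists (f : X -> Y) (g : Y -> X),
    [/\ cancel f g, cancel g f, continuous f & continuous g].

Definition metrizable (R : realType) (X : topologicalType) : Prop :=
  exists d : X -> X -> R,
    [/\ forall x y, (0 <= d x y)%R,
        forall x y, d x y = 0%R <-> x = y,
        forall x y, d x y = d y x,
        forall x y z, (d x z <= d x y + d y z)%R &
        forall (x : X) (A : set X),
          nbhs x A <-> exists2 e : R, (0 < e)%R & [set y | (d x y < e)%R] `<=` A].

Definition continuum (X : topologicalType) : Prop :=
  [/\ [set: X] !=set0, compact [set: X], connected [set: X]
    & hausdorff_space X].

Definition metric_continuum (R : realType) (X : topologicalType) : Prop :=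
  continuum X /\ metrizable R X.

(* The one-point continuum has to be set apart: its only base is the two-element
   lattice, so it is categorical. *)
Definition nondegenerate_space (X : topologicalType) : Prop :=
  exists x y : X, x <> y.

Definition elementarily_equivalent_spaces (X Y : topologicalType) : Prop :=
  exists (B : closed_base X) (C : closed_base Y),
    elementarily_equivalent_lattices (base_lattice B) (base_lattice C).

Definition categorical (R : realType) (X : topologicalType) : Prop :=
  forall Y : topologicalType, compact [set: Y] -> metrizable R Y ->
    elementarily_equivalent_spaces X Y -> homeomorphic Y X.

(* Main.v *)
Require Import Defs.
From HB Require Import structures.
From mathcomp Require Import finmap.
From mathcomp Require Import all_boot all_order all_algebra.
From mathcomp Require Import lra.
From mathcomp Require Import all_classical all_reals all_analysis.

Set Implicit Arguments.
Unset Strict Implicit.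
Unset Printing Implicit Defensive.

Import Order.TTheory GRing.Theory Num.Theory.
Import numFieldNormedType.Exports.

Local Open Scope classical_set_scope.

(** Let [phi_a t = min (a u, u)] with [u = t sin t], and let the [a]-spiral be
    the ray [(1 / (1 + t), phi_a t)], [t >= 0], in polar coordinates on a disc
    whose centre is blown up to a limit circle.  Two maps from a connected space
    onto the [a]- and the [b]-spiral, [0 < b < a <= 1], cannot be uniformly close:
    they would have to sweep almost the same angles, whereas [phi_a] reaches a
    high maximum [a t] before it goes below [- t], and [phi_b] does the opposite.
    As the continuous functions on a compact metric space form a separable space,
    no metric continuum maps onto the [a]-spiral for uncountably many [a] (a form
    of Waraszkiewicz's theorem).

    On the other hand, a nondegenerate metric continuum [X] maps onto arbitrarily
    long pieces of the [a]-spiral, through the distance to a point, so that an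
    ultracopower of [X] maps onto all of it.  By the theorems of Los and of
    Loewenheim and Skolem, so does the Wallman space of some countable elementary
    sublattice of an ultrapower of the lattice of closed sets of [X].  For some [a]
    this metric continuum is not homeomorphic to [X]. *)

(** * Elementary substructures of ultrapowers *)

(** Terms and formulas are encoded by trees in order to be countable types: there are then only
    countably many Skolem functions. *)
Fixpoint lat_term_tree (t : lat_term) : GenTree.tree nat :=
  match t with
  | LVar i => GenTree.Leaf i
  | LBot => GenTree.Node 0 [::]
  | LTop => GenTree.Node 1 [::]
  | LMeet t1 t2 => GenTree.Node 2 [:: lat_term_tree t1; lat_term_tree t2]
  | LJoin t1 t2 => GenTree.Node 3 [:: lat_term_tree t1; lat_term_tree t2]
  end.

Fixpoint tree_lat_term (t : GenTree.tree nat) : lat_term :=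
  match t with
  | GenTree.Leaf i => LVar i
  | GenTree.Node 1 _ => LTop
  | GenTree.Node 2 [:: t1; t2] => LMeet (tree_lat_term t1) (tree_lat_term t2)
  | GenTree.Node 3 [:: t1; t2] => LJoin (tree_lat_term t1) (tree_lat_term t2)
  | _ => LBot
  end.

Lemma lat_term_treeK : cancel lat_term_tree tree_lat_term.
Proof. by elim=> //= [t1 -> t2 ->|t1 -> t2 ->]. Qed.

HB.instance Definition _ := Countable.copy lat_term (can_type lat_term_treeK).

(** The number of children identifies the connective, so that the label of a unary node is free to
    record the bound variable. *)
Fixpoint lat_formula_tree (f : lat_formula) :
    GenTree.tree (lat_term * lat_term) :=
  match f with
  | LEq t1 t2 => GenTree.Leaf (t1, t2)
  | LFalse => GenTree.Node 0 [::]
  | LImp f1 f2 => GenTree.Node 0 [:: lat_formula_tree f1; lat_formula_tree f2]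
  | LForall i f1 => GenTree.Node i [:: lat_formula_tree f1]
  end.

Fixpoint tree_lat_formula (t : GenTree.tree (lat_term * lat_term)) :
    lat_formula :=
  match t with
  | GenTree.Leaf t => LEq t.1 t.2
  | GenTree.Node _ [:: t1; t2] =>
      LImp (tree_lat_formula t1) (tree_lat_formula t2)
  | GenTree.Node i [:: t1] => LForall i (tree_lat_formula t1)
  | _ => LFalse
  end.

Lemma lat_formula_treeK : cancel lat_formula_tree tree_lat_formula.
Proof. by elim=> //= [f1 -> f2 ->|i f1 ->]. Qed.

HB.instance Definition _ :=
  Countable.copy lat_formula (can_type lat_formula_treeK).

Section Semantics.
Context {d : Order.disp_t} (M : tbLatticeType d).
Implicit Types (e : nat -> M) (t : lat_term) (f : lat_formula).

Lemma eval_term_ext e e' t :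
  {in term_vars t, e =1 e'} -> eval_term e t = eval_term e' t.
Proof.
elim: t => //= [i ee'|t1 IH1 t2 IH2 ee'|t1 IH1 t2 IH2 ee'].
- by apply: ee'; rewrite inE.
- by congr (_ `&` _)%O; [apply: IH1|apply: IH2] => i it; apply: ee';
    rewrite mem_cat it ?orbT.
- by congr (_ `|` _)%O; [apply: IH1|apply: IH2] => i it; apply: ee';
    rewrite mem_cat it ?orbT.
Qed.

Lemma holds_ext e e' f :
  {in free_vars f, e =1 e'} -> holds e f <-> holds e' f.
Proof.
elim: f e e' => //= [t1 t2|f1 IH1 f2 IH2|i f1 IH1] e e' ee'.
- by rewrite (@eval_term_ext e e' t1) ?(@eval_term_ext e e' t2)// => j jt;
    apply: ee'; rewrite mem_cat jt ?orbT.
- have {}IH1 : holds e f1 <-> holds e' f1.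
    by apply: IH1 => j jf; apply: ee'; rewrite mem_cat jf.
  have {}IH2 : holds e f2 <-> holds e' f2.
    by apply: IH2 => j jf; apply: ee'; rewrite mem_cat jf orbT.
  by rewrite IH1 IH2.
- suff H a : holds (fun j => if j == i then a else e j) f1 <->
             holds (fun j => if j == i then a else e' j) f1.
    by split=> Hf a; apply/H.
  apply: IH1 => j jf; case: eqVneq => // ji.
  by apply: ee'; rewrite mem_filter ji.
Qed.

Lemma holds_ext_imp e e' f :
  e =1 e' -> holds e f -> holds e' f.
Proof. by move=> ee'; rewrite (_ : e = e')//; exact: funext. Qed.

End Semantics.

Lemma elementarily_equivalent_lattices_sym (d1 d2 : Order.disp_t)
    (L1 : tbLatticeType d1) (L2 : tbLatticeType d2) :
  elementarily_equivalent_lattices L1 L2 ->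
  elementarily_equivalent_lattices L2 L1.
Proof. by move=> E f sf; rewrite (E f sf). Qed.

Lemma elementarily_equivalent_lattices_trans (d1 d2 d3 : Order.disp_t)
    (L1 : tbLatticeType d1) (L2 : tbLatticeType d2) (L3 : tbLatticeType d3) :
  elementarily_equivalent_lattices L1 L2 ->
  elementarily_equivalent_lattices L2 L3 ->
  elementarily_equivalent_lattices L1 L3.
Proof. by move=> E E' f sf; rewrite (E f sf) (E' f sf). Qed.

(** * The theorem of Los *)

Section Ultrapower.
Context {d : Order.disp_t} (M : tbLatticeType d).
Context (U : set_system nat) {UU : UltraFilter U}.

Lemma ultra_near_not (P : nat -> Prop) :
  ~ (\forall n \near U, P n) <-> \forall n \near U, ~ P n.
Proof.
split=> [nP|UnP UP].
  by have [//|] := in_ultra_setVsetC [set n | P n] UU.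
by have [n []] := filter_ex (filterI UP UnP).
Qed.

Lemma ultra_near_or (P Q : nat -> Prop) :
  (\forall n \near U, P n \/ Q n) <->
  (\forall n \near U, P n) \/ (\forall n \near U, Q n).
Proof.
split=> [PQ|[]]; [|by apply: filterS => n; left|by apply: filterS => n; right].
have [|/ultra_near_not nP] := pselect (\forall n \near U, P n); first by left.
by right; apply: filterS2 PQ nP => n [].
Qed.

Definition update (T : Type) (e : nat -> T) i (a : T) :=
  fun j => if j == i then a else e j.

(* [L] represents an elementary substructure of the ultrapower of [M] modulo
   [U], in the form of the Tarski-Vaught test; [h] realises its quotient. *)
Variables (d' : Order.disp_t) (N : tbLatticeType d').
Variables (L : set (nat -> M)) (h : (nat -> M) -> N).
Hypothesis L0 : L (fun=> \bot)%O.
Hypothesis L1 : L (fun=> \top)%O.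
Hypothesis LI : forall A B, L A -> L B -> L (fun n => A n `&` B n)%O.
Hypothesis LU : forall A B, L A -> L B -> L (fun n => A n `|` B n)%O.
Hypothesis h0 : h (fun=> \bot)%O = \bot%O.
Hypothesis h1 : h (fun=> \top)%O = \top%O.
Hypothesis hI : forall A B, L A -> L B ->
  h (fun n => A n `&` B n)%O = (h A `&` h B)%O.
Hypothesis hU : forall A B, L A -> L B ->
  h (fun n => A n `|` B n)%O = (h A `|` h B)%O.
Hypothesis h_eq : forall A B, L A -> L B ->
  h A = h B <-> \forall n \near U, A n = B n.
Hypothesis h_surj : forall b, exists2 A, L A & h A = b.
Hypothesis L_witness : forall f i (e : nat -> nat -> M), (forall j, L (e j)) ->
  exists2 A, L A & forall n, (exists a, ~ holds (update (e^~ n) i a) f) ->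
    ~ holds (update (e^~ n) i (A n)) f.

Lemma eval_term_los (e : nat -> nat -> M) t : (forall j, L (e j)) ->
  L (fun n => eval_term (e^~ n) t) /\
  h (fun n => eval_term (e^~ n) t) = eval_term (h \o e) t.
Proof.
move=> Le; elim: t => //= [t1 [Lt1 IH1] t2 [Lt2 IH2]|t1 [Lt1 IH1] t2 [Lt2 IH2]].
- by split; [exact: LI|rewrite hI// IH1 IH2].
- by split; [exact: LU|rewrite hU// IH1 IH2].
Qed.

(** Induction on the formula. In the quantifier case [L_witness] serves the passage from [N] to the
    factors, and the surjectivity of [h] on [L] the converse. *)
Lemma los (e : nat -> nat -> M) f : (forall j, L (e j)) ->
  holds (h \o e) f <-> \forall n \near U, holds (e^~ n) f.
Proof.
elim: f e => [t1 t2|/=|f1 IH1 f2 IH2|i f1 IH1] e Le.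
- have [Lt1 ht1] := eval_term_los t1 Le.
  have [Lt2 ht2] := eval_term_los t2 Le.
  by rewrite /= -ht1 -ht2; exact: h_eq.
- by split=> // /filter_ex[].
- rewrite /= IH1// IH2//; split=> [H|H1 H2]; last exact: filterS2 H1 H2.
  have [/H|/ultra_near_not] := pselect (\forall n \near U, holds (e^~ n) f1).
    by apply: filterS.
  by apply: filterS.
- split=> [H|H a].
    apply: contrapT => /ultra_near_not nH.
    (* A single sequence of [L] provides a counterexample at every index that has one. *)
    have [A LA wA] := L_witness f1 i Le.
    have Lu j : L (update e i A j) by rewrite /update; case: eqP.
    have : holds (h \o update e i A) f1.
      apply: holds_ext_imp (H (h A)) => j /=.
      by rewrite /update; case: eqP.
    move/IH1 => /(_ Lu) => Hf.
    have [n [nHn Hn]] := filter_ex (filterI nH Hf).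
    have : exists a, ~ holds (update (e^~ n) i a) f1.
      by apply: contrapT => nex; apply: nHn => a; apply: contrapT => na;
        apply: nex; exists a.
    move/wA; apply; apply: holds_ext_imp Hn => j.
    by rewrite /update; case: eqP.
  have [A LA <-] := h_surj a.
  have Lu j : L (update e i A j) by rewrite /update; case: eqP.
  apply: (@holds_ext_imp _ _ (h \o update e i A)) => [j /=|].
    by rewrite /update; case: eqP.
  apply/IH1 => //; apply: filterS H => n /(_ (A n)).
  by apply: holds_ext_imp => j; rewrite /update; case: eqP.
Qed.

(** A sentence may be tested at the valuation constantly bottom, which is the same at all indices:
    truth at almost every index is then truth in [M]. *)
Lemma los_elementarily_equivalent : elementarily_equivalent_lattices M N.
Proof.
move=> f sf.
have ext (K : Order.disp_t) (T : tbLatticeType K) (e e' : nat -> T) :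
    holds e f <-> holds e' f.
  by apply: holds_ext; rewrite sf.
have los0 : holds (fun=> \bot%O : N) f <-> holds (fun=> \bot%O : M) f.
  transitivity (holds (h \o (fun _ _ => \bot%O)) f); first exact: ext.
  rewrite los//; split=> [/filter_ex[]//|H]; exact: nearW.
by split=> H e; apply/(ext _ _ _ (fun=> \bot%O)); apply/los0.
Qed.

End Ultrapower.

(** * Countable Skolem hulls *)

Section SkolemHull.
Context {d : Order.disp_t} (M : tbLatticeType d).
Variables (gen : nat -> nat -> M).
Variables (op : nat -> seq (nat -> M) -> nat -> M).

(** Counterexamples are chosen rather than examples, since the universal quantifier is the primitive
    one. The parameters form a finite list, so that the hull is made of values of finite trees. *)
Definition skolem_fun (f : lat_formula) (i : nat) (s : seq (nat -> M)) : nat -> M :=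
  fun n => xget \bot%O
    [set a | ~ holds (update (fun j => nth (fun=> \bot%O) s j n) i a) f].

(** The given operations and the Skolem functions share one numbering, so that trees with labels in
    [nat] name all members of the hull. *)
Definition hull_op (k : nat) : seq (nat -> M) -> nat -> M :=
  match unpickle k : option (nat + lat_formula * nat) with
  | Some (inl j) => op j
  | Some (inr (f, i)) => skolem_fun f i
  | None => fun _ _ => \bot%O
  end.

Fixpoint hull_eval (t : GenTree.tree nat) : nat -> M :=
  match t with
  | GenTree.Leaf i => gen i
  | GenTree.Node k ts => hull_op k (map hull_eval ts)
  end.

Definition skolem_hull : set (nat -> M) := range hull_eval.

Lemma countable_skolem_hull : countable skolem_hull.
Proof. exact: sub_countable (card_image_le _ _) (countableP _). Qed.

Lemma skolem_hull_gen i : skolem_hull (gen i).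
Proof. by exists (GenTree.Leaf i). Qed.

Lemma skolem_hull_hull_op k s :
  (forall A, A \in s -> skolem_hull A) -> skolem_hull (hull_op k s).
Proof.
move=> sH; suff [ts ->] : exists ts, s = map hull_eval ts.
  by exists (GenTree.Node k ts).
elim: s sH => [|A s IH] sH; first by exists [::].
have [t _ <-] := sH A (mem_head _ _).
have [|ts ->] := IH; first by move=> B Bs; apply: sH; rewrite inE Bs orbT.
by exists (t :: ts).
Qed.

Lemma skolem_hull_op k s :
  (forall A, A \in s -> skolem_hull A) -> skolem_hull (op k s).
Proof.
move=> /(skolem_hull_hull_op (pickle (inl k : nat + lat_formula * nat))).
by rewrite /hull_op pickleK.
Qed.

Lemma skolem_hull_witness f i (e : nat -> nat -> M) :
    (forall j, skolem_hull (e j)) ->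
  exists2 A, skolem_hull A & forall n,
    (exists a, ~ holds (update (e^~ n) i a) f) ->
    ~ holds (update (e^~ n) i (A n)) f.
Proof.
(* The valuation is cut down to a list just long enough to have every free variable of [f] among its
   positions. *)
move=> He; pose s := mkseq e (\max_(j <- free_vars f) j).+1.
have es j n : j \in free_vars f -> nth (fun=> \bot%O) s j n = e j n.
  by move=> jf; rewrite nth_mkseq// ltnS; exact: (@leq_bigmax_seq _ _ xpredT id).
have upd n a : holds (update (e^~ n) i a) f <->
    holds (update (fun j => nth (fun=> \bot%O) s j n) i a) f.
  by apply: holds_ext => j jf; rewrite /update es.
exists (skolem_fun f i s).
  have := @skolem_hull_hull_op (pickle (inr (f, i) : nat + lat_formula * nat)) s.
  by rewrite /hull_op pickleK; apply => A /mapP[j _ ->].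
by move=> n [a /upd na]; apply/upd; rewrite /skolem_fun; case: xgetP => [//|/(_ a)].
Qed.

End SkolemHull.

(** * Wallman spaces *)

(** Normality makes the space of maximal filters Hausdorff, and disjunctivity makes the lattice
    embed into its closed sets. *)
Record normal_set_lattice (W : Type) := NormalSetLattice {
  nsl_sets : set (set W);
  nsl0 : nsl_sets set0;
  nslT : nsl_sets setT;
  nslU : forall A B, nsl_sets A -> nsl_sets B -> nsl_sets (A `|` B);
  nslI : forall A B, nsl_sets A -> nsl_sets B -> nsl_sets (A `&` B);
  nsl_normal : forall A B, nsl_sets A -> nsl_sets B -> A `&` B = set0 ->
    exists P Q, [/\ nsl_sets P, nsl_sets Q, P `|` Q = setT,
      A `&` Q = set0 & B `&` P = set0];
  nsl_disjunctive : forall A B, nsl_sets A -> nsl_sets B -> ~ A `<=` B ->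
    exists C, [/\ nsl_sets C, C !=set0, C `<=` A & C `&` B = set0]
}.

(** Maximality is put as the existence of a disjoint member; upward closure within the lattice
    follows from it. *)
Record maximal_filter (W : Type) (L : set (set W)) (y : set (set W)) : Prop := {
  mf_sub : y `<=` L;
  mfI : forall A B, y A -> y B -> y (A `&` B);
  mf0 : ~ y set0;
  mf_max : forall A, L A -> ~ y A -> exists2 B, y B & A `&` B = set0
}.

(** Primeness is asked for pairs that cover the whole of [W], which are the pairs that normality
    produces. *)
Record prime_filter (W : Type) (L : set (set W)) (p : set (set W)) : Prop := {
  pf_sub : p `<=` L;
  pfT : p setT;
  pf0 : ~ p set0;
  pfI : forall A B, p A -> p B -> p (A `&` B);
  pfU : forall A B, L A -> L B -> A `|` B = setT -> p A \/ p B
}.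

Definition wallman (W : Type) (L : normal_set_lattice W) : Type :=
  {y | maximal_filter (nsl_sets L) y}.

HB.instance Definition _ W (L : normal_set_lattice W) := gen_eqMixin (wallman L).
HB.instance Definition _ W (L : normal_set_lattice W) := gen_choiceMixin (wallman L).

Definition wallman_set (W : Type) (L : normal_set_lattice W) (A : set W) :
  set (wallman L) := [set y | sval y A].
Arguments wallman_set {W} L A.

Section Wallman.
Context (W : Type) (L : normal_set_lattice W).
Implicit Types (A B C : set W) (y : wallman L).
Local Notation inL := (nsl_sets L).

Lemma wallmanP y : maximal_filter inL (sval y).
Proof. exact: svalP. Qed.

Lemma wallman_filterS y A B : inL B -> A `<=` B -> sval y A -> sval y B.
Proof.
move=> LB AB yA; have my := wallmanP y.
apply: contrapT => /(mf_max my LB)[C yC BC]; apply: (mf0 my).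
suff <- : A `&` C = set0 by exact: (mfI my).
by rewrite -subset0 -BC; exact: setSI.
Qed.

Lemma wallman_set0 : wallman_set L set0 = set0.
Proof. by rewrite -subset0 => y /(mf0 (wallmanP y)). Qed.

Lemma wallman_setT : wallman_set L setT = setT.
Proof.
rewrite -subTset => y _; have my := wallmanP y.
apply: contrapT => /(mf_max my (nslT L))[B yB].
by rewrite setTI => B0; apply: (mf0 my); rewrite -B0.
Qed.

Lemma wallman_setI A B : inL A -> inL B ->
  wallman_set L (A `&` B) = wallman_set L A `&` wallman_set L B.
Proof.
move=> LA LB; have LAB := nslI LA LB; apply/seteqP.
split=> y; last by move=> [yA yB]; exact: (mfI (wallmanP y)).
by move=> yAB; split; apply: wallman_filterS yAB.
Qed.

Lemma wallman_setU A B : inL A -> inL B ->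
  wallman_set L (A `|` B) = wallman_set L A `|` wallman_set L B.
Proof.
move=> LA LB; have LAB := nslU LA LB; apply/seteqP; split=> y; last first.
  by move=> [yA|yB]; [apply: wallman_filterS yA|apply: wallman_filterS yB].
move=> yAB; have my := wallmanP y; apply: contrapT => /not_orP[nA nB].
have [A' yA' AA'] := mf_max my LA nA.
have [B' yB' BB'] := mf_max my LB nB.
apply: (mf0 my); suff <- : (A `|` B) `&` (A' `&` B') = set0.
  by apply: (mfI my) => //; exact: (mfI my).
rewrite -subset0 => w [[Aw|Bw] [A'w B'w]].
  by have : (A `&` A') w by []; rewrite AA'.
by have : (B `&` B') w by []; rewrite BB'.
Qed.

Let op : set_system (wallman L) := [set O | forall y, O y ->
  exists A, [/\ inL A, ~ sval y A & ~` wallman_set L A `<=` O]].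

Let opT : op setT.
Proof.
move=> y _; exists set0; split => //; first exact: nsl0.
exact: (mf0 (wallmanP y)).
Qed.

Let opI : setI_closed op.
Proof.
move=> O O' oO oO' y [/oO[A [LA yA AO]] /oO'[B [LB yB BO]]].
exists (A `|` B); split; first exact: nslU.
  have : ~ (wallman_set L (A `|` B)) y by rewrite wallman_setU// => -[].
  by [].
by rewrite wallman_setU// setCU; exact: setISS.
Qed.

Let op_bigU (I : Type) (f : I -> set (wallman L)) :
  (forall i, op (f i)) -> op (\bigcup_i f i).
Proof.
move=> of_ y [i _ /of_[A [LA yA Af]]]; exists A; split => //.
by move=> z /Af fz; exists i.
Qed.

HB.instance Definition _ :=
  @isOpenTopological.Build (wallman L) op opT opI op_bigU.

End Wallman.

(* [compact_cover] is only available on pointed spaces. *)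
Lemma compact_cover_compact (T : topologicalType) (A : set T) :
  compact A -> cover_compact A.
Proof.
have [->|/set0P[x _]] := eqVneq A set0.
  by move=> _ I D f _ _; exists fset0 => //; exact: sub0set.
pose pT : ptopologicalType := HB.pack (Topological.sort T) (isPointed.Build T x).
by rewrite -[cover_compact A]/(@cover_compact pT A) -(@compact_cover pT).
Qed.

Section WallmanTopology.
Context (W : Type) (L : normal_set_lattice W).
Implicit Types (A B C : set W) (y : wallman L).
Local Notation inL := (nsl_sets L).

Lemma wallman_openE (O : set (wallman L)) : open O = (forall y, O y ->
  exists A, [/\ inL A, ~ sval y A & ~` wallman_set L A `<=` O]).
Proof. by []. Qed.

Lemma wallman_nbhsP y (V : set (wallman L)) : nbhs y V <->
  exists A, [/\ inL A, ~ sval y A & ~` wallman_set L A `<=` V].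
Proof.
rewrite nbhsE; split=> [[G [oG Gy] GV]|[A [LA yA AV]]].
  move: oG; rewrite wallman_openE => /(_ y Gy)[A [LA yA AG]].
  by exists A; split => //; exact: subset_trans GV.
exists (~` wallman_set L A) => //; split => //.
rewrite wallman_openE => z zA; exists A; split => //.
Qed.

Lemma wallman_set_closed A : inL A -> closed (wallman_set L A).
Proof.
by move=> LA; rewrite -openC wallman_openE => z zA; exists A; split.
Qed.

(* A prime filter [p] lies in exactly one maximal filter; it consists of the
   sets that meet all members of [p]. *)
Lemma maximal_of_prime (p : set (set W)) : prime_filter inL p ->
  maximal_filter inL [set A | inL A /\ forall B, p B -> A `&` B !=set0].
Proof.
move=> pp; split=> [A []//|A B [LA pA] [LB pB]||A LA nA].
- split=> [|C pC]; first exact: nslI.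
  apply/set0P/eqP => ABC0; have LC := pf_sub pp pC.
  (* If [A], [B] and [C] had no common point, normality would separate [A] from [B] within [C] by a
     covering pair [P], [Q]. Whichever of the two lies in [p] then contradicts that [A] and [B] meet
     all members of [p]. *)
  have [| | |P [Q [LP LQ PQ AQ BP]]] :=
    @nsl_normal _ L (A `&` C) (B `&` C); [exact: nslI|exact: nslI| |].
    by rewrite setIACA setIid.
  have [pP|pQ] := pfU pp LP LQ PQ.
    have [w [Bw [Cw Pw]]] := pB _ (pfI pp pC pP).
    by have : ((B `&` C) `&` P) w by []; rewrite BP.
  have [w [Aw [Cw Qw]]] := pA _ (pfI pp pC pQ).
  by have : ((A `&` C) `&` Q) w by []; rewrite AQ.
- by move=> [_ /(_ _ (pfT pp))[w []]].
- have [B pB AB] : exists2 B, p B & A `&` B = set0.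
    apply: contrapT => nB; apply: nA; split => // B pB.
    by apply/set0P/eqP => AB; apply: nB; exists B.
  exists B => //; split=> [|C pC]; first exact: (pf_sub pp).
  apply/set0P/eqP => BC; apply: (pf0 pp); rewrite -BC; exact: (pfI pp).
Qed.

Definition wallman_of_prime p (pp : prime_filter inL p) : wallman L :=
  exist _ _ (maximal_of_prime pp).

Lemma prime_filter_point (w : W) : prime_filter inL [set A | inL A /\ A w].
Proof.
split=> [A []//| | |A B [LA Aw] [LB Bw]|A B LA LB AB].
- by split => //; exact: nslT.
- by move=> [].
- by split => //; exact: nslI.
- by have : (A `|` B) w; [rewrite AB|case; [left|right]].
Qed.

(** The lattice sets through [w] form a prime filter, which need not be maximal; it is replaced by
    the maximal filter above it. *)
Definition wallman_point (w : W) : wallman L :=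
  wallman_of_prime (prime_filter_point w).

Lemma wallman_pointP w A : inL A -> A w -> sval (wallman_point w) A.
Proof. by move=> LA Aw; split => // B [_ Bw]; exists w. Qed.

(** The lattice sets whose basic closed sets belong to an ultrafilter form a prime filter, and the
    ultrafilter converges to the maximal filter above it. *)
Lemma wallman_compact : compact [set: wallman L].
Proof.
rewrite compact_ultra => F FU _.
have pp : prime_filter inL [set A | inL A /\ F (wallman_set L A)].
  split=> [A []//| | |A B [LA FA] [LB FB]|A B LA LB AB].
  - by split; [exact: nslT|rewrite wallman_setT; exact: filterT].
  - by move=> [_]; rewrite wallman_set0 => /filter_ex[].
  - by split; [exact: nslI|rewrite wallman_setI//; exact: filterI].
  - have [|FA] := in_ultra_setVsetC (wallman_set L A) FU; first by left.
    right; split => //; apply: filterS FA => z zA.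
    have : wallman_set L (A `|` B) z by rewrite AB wallman_setT.
    by rewrite wallman_setU// => -[].
exists (wallman_of_prime pp); split=> // V /wallman_nbhsP[A [LA nA AV]].
have [B [LB FB] AB] : exists2 B, inL B /\ F (wallman_set L B) & A `&` B = set0.
  apply: contrapT => nB; apply: nA; split => // B [LB FB].
  by apply/set0P/eqP => AB; apply: nB; exists B.
apply: filterS FB => z zB; apply: AV => zA.
have : (wallman_set L (A `&` B)) z by rewrite wallman_setI.
by rewrite AB wallman_set0.
Qed.

Lemma wallman_neq y z : y <> z -> exists2 A, sval y A & ~ sval z A.
Proof.
move=> yz; apply: contrapT => nA.
have yz' : sval y `<=` sval z.
  by move=> A yA; apply: contrapT => zA; apply: nA; exists A.
apply: yz; apply: eq_sig_hprop => [?|]; first exact: Prop_irrelevance.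
apply/seteqP; split=> // A zA.
apply: contrapT => /(mf_max (wallmanP y) (mf_sub (wallmanP z) zA))[B yB AB].
by apply: (mf0 (wallmanP z)); rewrite -AB; apply: (mfI (wallmanP z)) => //; exact: yz'.
Qed.

Lemma wallman_hausdorff : hausdorff_space (wallman L).
Proof.
rewrite open_hausdorff => y z /eqP /wallman_neq[A yA zA].
have LA := mf_sub (wallmanP y) yA.
have [B zB AB] := mf_max (wallmanP z) LA zA.
have LB := mf_sub (wallmanP z) zB.
have [P [Q [LP LQ PQ AQ BP]]] := nsl_normal LA LB AB.
exists (~` wallman_set L Q, ~` wallman_set L P) => /=.
  rewrite !inE; split=> yP.
    have : wallman_set L (A `&` Q) y by rewrite wallman_setI.
    by rewrite AQ wallman_set0.
  have : wallman_set L (B `&` P) z by rewrite wallman_setI.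
  by rewrite BP wallman_set0.
split; [by rewrite openC; exact: wallman_set_closed..|].
by rewrite -setCU -wallman_setU// setUC PQ wallman_setT setCT.
Qed.

(** Otherwise disjunctivity gives a nonempty lattice set inside [A] and off [B], and any of its
    points yields a maximal filter that contains [A] but not [B]. *)
Lemma wallman_set_sub A B : inL A -> inL B ->
  wallman_set L A `<=` wallman_set L B -> A `<=` B.
Proof.
move=> LA LB AB; apply: contrapT.
move=> /(nsl_disjunctive LA LB)[C [LC [w Cw] CA CB]].
have wC := wallman_pointP LC Cw.
have /AB wB : wallman_set L A (wallman_point w) by exact: wallman_filterS wC.
have : wallman_set L (C `&` B) (wallman_point w) by rewrite wallman_setI.
by rewrite CB wallman_set0.
Qed.

Lemma wallman_set_inj A B : inL A -> inL B ->
  wallman_set L A = wallman_set L B -> A = B.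
Proof.
by move=> LA LB AB; apply/seteqP; split; apply: wallman_set_sub => //; rewrite AB.
Qed.

Definition wallman_sets : set (set (wallman L)) := [set wallman_set L A | A in inL].

Lemma wallman_sets_generates F : closed F ->
  exists2 S : set (set (wallman L)), S `<=` wallman_sets & F = \bigcap_(A in S) A.
Proof.
move=> cF; exists [set A | wallman_sets A /\ F `<=` A]; first by move=> A [].
apply/seteqP; split=> [y Fy A [_ FA]|y yF]; first exact: FA.
apply: contrapT => nFy; have : open (~` F) by rewrite openC.
rewrite wallman_openE => /(_ y nFy)[A [LA yA AF]].
apply: yA; apply: (yF (wallman_set L A)); split; first by exists A.
by move=> z Fz; apply: contrapT => /AF.
Qed.

Definition wallman_base : closed_base (wallman L).
Proof.
exists wallman_sets.
- by move=> _ [A LA <-]; exact: wallman_set_closed.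
- exact: wallman_sets_generates.
- by exists set0; [exact: nsl0|rewrite wallman_set0].
- by exists setT; [exact: nslT|rewrite wallman_setT].
- move=> _ _ [A LA <-] [B LB <-]; exists (A `|` B); first exact: nslU.
  by rewrite wallman_setU.
- move=> _ _ [A LA <-] [B LB <-]; exists (A `&` B); first exact: nslI.
  by rewrite wallman_setI.
Defined.

(** Being closed, [O] is an intersection of basic closed sets; its complement being compact,
    finitely many of them suffice, and the lattice is closed under finite intersections. *)
Lemma wallman_clopen (O : set (wallman L)) : open O -> closed O ->
  exists2 A, inL A & O = wallman_set L A.
Proof.
move=> oO cO.
pose D := [set A : set W | inL A /\ ~` wallman_set L A `<=` ~` O].
have cocO : compact (~` O).
  by apply: (subclosed_compact _ wallman_compact) => //; rewrite closedC.
have := @compact_cover_compact _ _ cocO _ D (fun A => ~` wallman_set L A).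
case=> [A [LA _]|y nOy|E ED cE].
- by rewrite openC; exact: wallman_set_closed.
- have : open (~` O) by rewrite openC.
  by rewrite wallman_openE => /(_ y nOy)[A [LA yA AO]]; exists A.
- have LE A : A \in (E : seq _) -> inL A by move=> /ED; rewrite inE => -[].
  pose B := \big[setI/setT]_(A <- E) A.
  have [LB BE] : inL B /\ wallman_set L B = \big[setI/setT]_(A <- E) wallman_set L A.
    rewrite /B; elim: (E : seq _) LE => [|A s IH] LE.
      by rewrite !big_nil wallman_setT; split => //; exact: nslT.
    have LA : inL A by apply: LE; rewrite mem_head.
    have [|LI IE] := IH; first by move=> C Cs; apply: LE; rewrite inE Cs orbT.
    rewrite !big_cons; split; first exact: nslI.
    by rewrite wallman_setI// IE.
  exists B => //; rewrite BE -bigcap_seq; apply/seteqP; split=> [y Oy A /= AE|y yE].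
    have := ED A AE; rewrite inE => -[_ AO]; apply: contrapT => yA.
    exact: AO yA Oy.
  by apply: contrapT => /cE[A AE yA]; apply: yA; exact: yE.
Qed.

Lemma wallman_connected :
  (forall A B, inL A -> inL B -> A `|` B = setT -> A `&` B = set0 ->
    A = set0 \/ B = set0) ->
  connected [set: wallman L].
Proof.
move=> conL O [y Oy] [ O1 oO1 OE1] [ O2 cO2 OE2].
rewrite setTI in OE1; rewrite setTI in OE2.
have oO : open O by rewrite OE1.
have cO : closed O by rewrite OE2.
have [A LA OA] := wallman_clopen oO cO.
have [B LB OB] : exists2 B, inL B & ~` O = wallman_set L B.
  by apply: wallman_clopen; [rewrite openC|rewrite closedC].
have [||A0|B0] := conL A B LA LB.
- apply: wallman_set_inj; [exact: nslU|exact: nslT|].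
  by rewrite wallman_setU// -OA -OB wallman_setT setUv.
- apply: wallman_set_inj; [exact: nslI|exact: nsl0|].
  by rewrite wallman_setI// -OA -OB wallman_set0 setICr.
- by move: Oy; rewrite OA A0 wallman_set0.
- by rewrite -(setCK O) OB B0 wallman_set0 setC0.
Qed.

Lemma countable_wallman_sets : countable inL -> countable wallman_sets.
Proof. exact/sub_countable/card_image_le. Qed.

End WallmanTopology.

(** * Extension of bounded functions to the Wallman space *)

Lemma ultra_bounded_cvg (R : realType) (T : Type) (G : set_system T)
    (g : T -> R) (M : R) : UltraFilter G -> (forall x, `|g x| <= M)%R ->
  cvg (g x @[x --> G]).
Proof.
move=> GU gM.
have [|p [_ cp]] := @segment_compact R (- M)%R M (g x @[x --> G]).
  apply: (@filterS _ G _ setT) => [x _|]; last exact: filterT.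
  by rewrite /= in_itv/= -ler_norml.
apply/cvg_ex; exists p => V pV.
have [//|GV] := in_ultra_setVsetC (g @^-1` V) GU.
by have [z []] := cp (~` V) V GV pV.
Qed.

Section WallmanExtension.
Context (R : realType) (W : Type) (L : normal_set_lattice W).
Implicit Types (A B C : set W) (y : wallman L) (g : W -> R).
Local Notation inL := (nsl_sets L).
Local Open Scope ring_scope.

Lemma wallman_ultra_ex y : exists G, UltraFilter G /\ sval y `<=` G.
Proof.
have my := wallmanP y.
have PF : ProperFilter (filter_from (sval y) id).
  apply: filter_from_proper => [|A yA].
    apply: filter_from_filter => [|A B yA yB]; last first.
      by exists (A `&` B) => //; exact: (mfI my).
    exists setT; have : wallman_set L setT y by rewrite wallman_setT.
    by [].
  by apply/set0P/eqP => A0; apply: (mf0 my); rewrite -A0.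
have [G [GU yG]] := ultraFilterLemma PF.
by exists G; split => // A yA; apply: yG; exists A.
Qed.

(** A point [y] only decides membership in lattice sets, so limits are taken along a chosen
    ultrafilter on [W] that extends it. *)
Definition wallman_ultra y : set_system W := projT1 (cid (wallman_ultra_ex y)).

Lemma wallman_ultraP y : UltraFilter (wallman_ultra y).
Proof. by rewrite /wallman_ultra; case: cid => G []. Qed.

Lemma wallman_ultra_sub y : sval y `<=` wallman_ultra y.
Proof. by rewrite /wallman_ultra; case: cid => G []. Qed.

Lemma wallman_ultra_notin y A : inL A -> ~ sval y A -> wallman_ultra y (~` A).
Proof.
move=> LA /(mf_max (wallmanP y) LA)[B yB AB].
have GU := wallman_ultraP y.
apply: filterS (wallman_ultra_sub yB); apply/disjoints_subset.
by rewrite setIC.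
Qed.

Definition wallman_extend g y : R := lim (g w @[w --> wallman_ultra y]).

Definition bounded1 g := forall w, `|g w| <= 1.

(** The lattice interpolates between sublevel sets. This makes the extension of [g] lower
    semicontinuous; the same for the opposite of [g] makes it continuous. *)
Definition lattice_separates g := forall a b : R, a < b ->
  exists A, [/\ inL A, (forall w, g w <= a -> A w) & (forall w, A w -> g w <= b)].

Lemma wallman_extend_cvg g y : bounded1 g ->
  g w @[w --> wallman_ultra y] --> wallman_extend g y.
Proof.
move=> g1; apply: (@ultra_bounded_cvg R W _ g 1) => //; exact: wallman_ultraP.
Qed.

Lemma is_cvg_wallman_extend g y : bounded1 g ->
  cvg (g w @[w --> wallman_ultra y]).
Proof.
by move=> g1; apply/cvg_ex; eexists; exact: (wallman_extend_cvg (y := y) g1).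
Qed.

Lemma wallman_extendN g y : bounded1 g ->
  wallman_extend (\- g) y = - wallman_extend g y.
Proof.
move=> g1; have GU := wallman_ultraP y; apply: cvg_lim => //.
by apply: cvgN; exact: wallman_extend_cvg.
Qed.

(** A lattice set that interpolates between level [c] and the midpoint [c'] is not in [y], as the
    limit would be at most [c']. At all points that do not contain it, the limit is at least [c]. *)
Lemma wallman_extend_lower g y (c : R) : bounded1 g -> lattice_separates g ->
  c < wallman_extend g y -> \forall z \near y, c <= wallman_extend g z.
Proof.
move=> g1 gL cy; pose c' := (c + wallman_extend g y) / 2.
have [A [LA cA Ac]] := gL c c' (midf_lt cy).1.
have GU := wallman_ultraP y.
apply/wallman_nbhsP; exists A; split => // [/wallman_ultra_sub GA|z zA].
  have : wallman_extend g y <= c'.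
    apply: limr_le; first exact: is_cvg_wallman_extend.
    exact: filterS GA.
  by rewrite leNgt (midf_lt cy).2.
have GzU := wallman_ultraP z.
apply: limr_ge; first exact: is_cvg_wallman_extend.
have := wallman_ultra_notin LA zA; apply: filterS => w nA.
by rewrite leNgt; apply/negP => /ltW/cA.
Qed.

Lemma wallman_extend_continuous g : bounded1 g ->
  lattice_separates g -> lattice_separates (\- g) ->
  continuous (wallman_extend g).
Proof.
move=> g1 gL NgL y.
have Fy : Filter (nbhs y) by exact: nbhs_filter.
apply/(@cvgrPdist_le _ _ _ (nbhs y) Fy) => e e0.
have Ng1 : bounded1 (\- g) by move=> w; rewrite normrN.
have lo : \forall z \near y, wallman_extend g y - e <= wallman_extend g z.
  by apply: wallman_extend_lower => //; rewrite ltrBlDr ltrDl.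
have hi : \forall z \near y,
    wallman_extend (\- g) y - e <= wallman_extend (\- g) z.
  by apply: wallman_extend_lower => //; rewrite ltrBlDr ltrDl.
apply: (@filterS2 _ (nbhs y) (nbhs_filter y) _ _ _ _ lo hi) => z.
rewrite !wallman_extendN// => {}lo {}hi.
by rewrite ler_distl; apply/andP; split; lra.
Qed.

Lemma wallman_extend_point_le g (w : W) : bounded1 g -> lattice_separates g ->
  wallman_extend g (wallman_point L w) <= g w.
Proof.
move=> g1 gL; rewrite leNgt; apply/negP => gw.
have [A [LA cA Ac]] := gL _ _ (midf_lt gw).1.
have := @wallman_pointP _ L w A LA (cA w (lexx _)).
move=> /wallman_ultra_sub GA; have GU := wallman_ultraP (wallman_point L w).
have : wallman_extend g (wallman_point L w) <=
    (g w + wallman_extend g (wallman_point L w)) / 2.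
  apply: limr_le; last exact: filterS GA.
  exact: is_cvg_wallman_extend.
by rewrite leNgt (midf_lt gw).2.
Qed.

Lemma wallman_extend_point g (w : W) : bounded1 g ->
  lattice_separates g -> lattice_separates (\- g) ->
  wallman_extend g (wallman_point L w) = g w.
Proof.
move=> g1 gL NgL; apply/eqP; rewrite eq_le wallman_extend_point_le//=.
rewrite -lerN2 -wallman_extendN//; apply: wallman_extend_point_le => //.
by move=> v; rewrite normrN.
Qed.

End WallmanExtension.

(** * Countable bases and metrizability *)

Lemma countable_enum (T : choiceType) (x0 : T) (A : set T) : countable A ->
  exists e : nat -> T, forall x, A x -> exists n, e n = x.
Proof.
move=> /countable_injP[i iA]; exists (fun n => xget x0 [set x | A x /\ i x = n]).
move=> x Ax; exists (i x); case: xgetP => [y _ [Ay iyx]|/(_ x)[]//].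
by apply: iA => //; rewrite inE.
Qed.

(** [F] is an intersection of members of the base, whose complements cover the compact set [K]; a
    finite subcover gives a finite intersection. *)
Lemma closed_base_separation (X : topologicalType) (B : closed_base X)
    (F K : set X) : compact [set: X] -> closed F -> closed K ->
  F `&` K = set0 ->
  exists Q, [/\ base_sets B Q, F `<=` Q & Q `&` K = set0].
Proof.
move=> cX cF cK FK; have [S SB FE] := base_generates B cF.
have coK : compact K by exact: subclosed_compact cK cX _.
have := @compact_cover_compact _ _ coK _ S (fun A => ~` A).
case=> [A /SB/base_closed|x Kx|E ES EK]; first by rewrite openC.
  have : ~ F x by move=> Fx; have : (F `&` K) x by []; rewrite FK.
  by rewrite FE => /existsNP[A /not_implyP[SA Ax]]; exists A.
exists (\big[setI/setT]_(A <- E) A); split.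
- have {EK} : {subset (E : seq _) <= S} by [].
  elim: (E : seq _) => [|A s IH] sS; first by rewrite big_nil; exact: base_setT.
  rewrite big_cons; apply: base_setI.
    by apply: SB; have := sS A (mem_head _ _); rewrite inE.
  by apply: IH => C Cs; apply: sS; rewrite inE Cs orbT.
- rewrite FE -bigcap_seq => x Sx A /= AE; apply: Sx.
  by have := ES A AE; rewrite inE.
- rewrite -subset0 -bigcap_seq => x [xE /EK[A AE]]; apply; exact: xE.
Qed.

Section UrysohnMetrization.
Context (R : realType) (X : topologicalType) (B : closed_base X).
Hypotheses (cX : compact [set: X]) (hX : hausdorff_space X).
Hypothesis cB : countable (base_sets B).
Local Open Scope ring_scope.

(** Urysohn functions of the countably many pairs of members of the base. *)
Let sep : exists f : nat -> X -> R, [/\ forall k, continuous (f k),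
  forall k x, 0 <= f k x <= 1 &
  forall x V, nbhs x V -> exists k, f k x = 0 /\ forall y, f k y < 1 -> V y].
Proof.
have [e eB] := countable_enum set0 cB.
exists (fun k => if unpickle k is Some (m, n) then @Urysohn _ R (e m) (e n)
  else cst 0); split=> [k|k x|x V].
- by case: unpickle => [[m n]|]; [exact: Urysohn_continuous|exact: cst_continuous].
- case: unpickle => [[m n]|]; last by rewrite lexx ler01.
  have : range (@Urysohn _ R (e m) (e n)) (@Urysohn _ R (e m) (e n) x) by exists x.
  by move/Urysohn_range; rewrite /= in_itv.
- rewrite nbhsE => -[G [oG Gx] GV].
  have cG : closed (~` G) by rewrite closedC.
  have c1 : closed [set x] by exact/accessible_closed_set1/hausdorff_accessible.
  (* Separating twice encloses [x] and the complement of [G] in disjoint members [Q] and [P] of the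
     base. *)
  have [|Q [BQ xQ QG]] := closed_base_separation B cX c1 cG.
    by rewrite -subset0 => _ [-> /(_ Gx)].
  have cQ := base_closed BQ.
  have [|P [BP GP PQ]] := closed_base_separation B cX cG cQ.
    by rewrite setIC.
  have [[m em] [n en]] := (eB Q BQ, eB P BP).
  have sQP : uniform_separator Q P.
    have /normal_separatorP nX := compact_normal hX cX.
    by apply: nX => //; [exact: base_closed BP|rewrite setIC].
  exists (pickle (m, n)); rewrite pickleK em en; split.
    by apply: (Urysohn_sub0 sQP); exists x => //; exact: xQ.
  move=> y f1; apply: GV; apply: contrapT => /GP Py.
  have : [set 1] (@Urysohn _ R Q P y) by apply: (Urysohn_sub1 sQP); exists y.
  by move=> /= U1; rewrite U1 ltxx in f1.
Qed.

Lemma countable_base_metrizable : metrizable R X.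
Proof.
have [f [fc f01 fsep]] := sep.
(* The weights tend to [0] and the differences are at most [1], so that at each scale only finitely
   many functions matter to the supremum. *)
pose D x y := range (fun k : nat => k.+1%:R^-1 * `|f k x - f k y|).
have f1 k x y : `|f k x - f k y| <= 1.
  have /andP[? ?] := f01 k x; have /andP[? ?] := f01 k y.
  by rewrite ler_norml; apply/andP; split; lra.
have k1 (k : nat) : k.+1%:R^-1 <= 1 :> R by rewrite invf_le1 ?ler1n.
have D1 x y : ubound (D x y) 1.
  by move=> _ [k _ <-]; rewrite mulr_ile1// invr_ge0.
have hD x y : has_sup (D x y) by split;
  [exists (1%:R^-1 * `|f 0%N x - f 0%N y|); exists 0%N|exists 1].
pose d x y := sup (D x y).
have dle x y k : k.+1%:R^-1 * `|f k x - f k y| <= d x y.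
  by apply: ub_le_sup; [exists 1; exact: D1|exists k].
have led x y c : (forall k, k.+1%:R^-1 * `|f k x - f k y| <= c) -> d x y <= c.
  move=> H; apply: ge_sup; first by have [] := hD x y.
  by move=> _ [k _ <-].
have d0 x y : 0 <= d x y by apply: le_trans (dle x y 0%N); rewrite mulr_ge0.
have ball_nbhs x V : nbhs x V ->
    exists2 e : R, 0 < e & [set y | d x y < e] `<=` V.
  move=> /fsep[k [fx fV]]; exists k.+1%:R^-1 => // y /= dy.
  apply: fV; have := le_lt_trans (dle x y k) dy.
  rewrite -[ltRHS]mulr1 ltr_pM2l// fx sub0r normrN.
  by apply: le_lt_trans; exact: ler_norm.
exists d; split => //.
- move=> x y; split=> [dxy|->]; last first.
    apply/eqP; rewrite eq_le d0 andbT; apply: led => k.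
    by rewrite subrr normr0 mulr0.
  apply: contrapT => xy.
  have [e e0 /(_ y)] : exists2 e : R, 0 < e & [set z | d x z < e] `<=` ~` [set y].
    apply: ball_nbhs; apply: open_nbhs_nbhs; split; last by move=> /= ?; exact: xy.
    by rewrite openC; exact/accessible_closed_set1/hausdorff_accessible.
  by rewrite /= dxy => /(_ e0); apply.
- by move=> x y; congr sup; apply/seteqP; split=> _ [k _ <-]; exists k => //;
    rewrite distrC.
- move=> x y z; apply: led => k; apply: le_trans (lerD (dle x y k) (dle y z k)).
  by rewrite -mulrDr ler_pM2l// ler_distD.
- move=> x V; split=> [/ball_nbhs//|[e e0 eV]]; apply: filterS eV _.
  have e20 : 0 < e / 2 by rewrite divr_gt0.
  (* From [N] on, the weights alone keep the terms below [e / 2]. *)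
  have [N _ /(_ N (leqnn N)) Ne] := near_infty_natSinv_lt (PosNum e20).
  have nearN n : \forall y \near x, forall k, (k < n)%N -> `|f k x - f k y| <= e / 2.
    elim: n => [|n IH]; first exact: nearW.
    have := fc n x; move/cvgrPdist_le => /(_ _ e20) fn.
    apply: filterS2 IH fn => y IH fn k; rewrite ltnS leq_eqVlt => /predU1P[->//|].
    exact: IH.
  apply: filterS (nearN N) => y H /=.
  apply: (@le_lt_trans _ _ (e / 2)); last by rewrite gtr_pMr// invf_lt1 ?ltr1n.
  apply: led => k; have [kN|Nk] := ltnP k N.
    by apply: le_trans (H k kN); rewrite ler_piMl.
  apply: (@le_trans _ _ k.+1%:R^-1); first by rewrite ler_piMr.
  by apply: le_trans (ltW Ne); rewrite lef_pV2 ?posrE// ler_nat.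
Qed.

End UrysohnMetrization.

Section MetricBase.
Context (R : realType) (X : topologicalType).
Local Open Scope ring_scope.

(** The sequence lists the complements of the balls of finite covers, one cover for each radius
    [1 / (m + 1)]. *)
Lemma metrizable_separating_sequence : compact [set: X] -> metrizable R X ->
  exists gen : nat -> set X, (forall n, closed (gen n)) /\
    forall F x, closed F -> ~ F x -> exists n, F `<=` gen n /\ ~ gen n x.
Proof.
move=> cX [d [d0 dE dC dT dN]].
pose b x (m : nat) := [set y | d x y < m.+1%:R^-1].
have ob x m : open (b x m).
  rewrite openE => y /= by_; apply/dN; exists (m.+1%:R^-1 - d x y).
    by rewrite subr_gt0.
  move=> z /= yz; apply: le_lt_trans (dT x y z) _; rewrite -ltrBrDl.
  exact: yz.
have bx x m : b x m x by rewrite /b /= (dE x x).2.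
have cov m : exists E : seq X, forall x, exists2 j, (j < size E)%N & b (nth x E j) m x.
  have [x _|x _|E _ cE] := @compact_cover_compact _ _ cX _ setT (b^~ m).
  - exact: ob.
  - by exists x.
  - exists E => x; have [y yE yx] := cE x I.
    exists (index y E); first by rewrite index_mem.
    by rewrite nth_index.
have [E EP] := choice cov.
have [x0|X0] := pselect (exists x : X, True); last first.
  by exists (fun=> setT); split=> [n|F x]; [exact: closedT|have := X0 (ex_intro _ x I)].
have {x0} [x0 _] := x0.
exists (fun k => if unpickle k is Some (m, j) then ~` b (nth x0 (E m) j) m else setT).
split=> [n|F x cF Fx].
  by case: unpickle => [[m j]|]; [rewrite closedC|exact: closedT].
have [e e0 eF] : exists2 e : R, 0 < e & [set y | d x y < e] `<=` ~` F.
  by apply/dN; apply: open_nbhs_nbhs; split => //; rewrite openC.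
have e20 : 0 < e / 2 by rewrite divr_gt0.
(* A ball of radius below [e / 2] that contains [x] lies within distance [e] of [x], hence misses
   [F]. *)
have [m _ /(_ m (leqnn m)) /= me] := near_infty_natSinv_lt (PosNum e20).
have [j jE jx] := EP m x; rewrite (set_nth_default x0)// in jx.
exists (pickle (m, j)); rewrite pickleK; split=> [y Fy yb|]; last exact.
apply: (eF y) => //=; move: jx yb; rewrite /b /= => jx yb.
apply: le_lt_trans (dT x (nth x0 (E m) j) y) _.
rewrite (splitr e) (dC x); apply: ltrD; apply: lt_trans me; [exact: jx|exact: yb].
Qed.

End MetricBase.

(** * The lattice of an ultracopower *)

Definition all_closed (X : topologicalType) : closed_base X.
Proof.
exists closed => //.
- by move=> F cF; exists [set F]; [move=> _ ->|rewrite bigcap_set1].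
- exact: closed0.
- by move=> A B; exact: closedU.
- by move=> A B; exact: closedI.
Defined.

Section ClosedLattice.
Context (X : topologicalType).

Definition closed_lattice := base_lattice (all_closed X).
HB.instance Definition _ := Order.TBLattice.on closed_lattice.

Definition closed_elt (A : set X) (cA : closed A) : closed_lattice :=
  exist _ A (mem_set (cA : base_sets (all_closed X) A)).

Definition elt_set (A : closed_lattice) : set X := sval A.

Lemma elt_set_inj : injective elt_set.
Proof. exact: val_inj. Qed.

Lemma elt_set_closed (A : closed_lattice) : closed (elt_set A).
Proof. by case: A => A /=; rewrite inE. Qed.

Lemma elt_setI (A B : closed_lattice) :
  elt_set (A `&` B)%O = elt_set A `&` elt_set B.
Proof. exact: base_lattice_meetE. Qed.

Lemma elt_setU (A B : closed_lattice) :
  elt_set (A `|` B)%O = elt_set A `|` elt_set B.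
Proof. exact: base_lattice_joinE. Qed.

Lemma elt_set0 : elt_set \bot%O = set0.
Proof. exact: base_lattice_botE. Qed.

Lemma elt_setT : elt_set \top%O = setT.
Proof. exact: base_lattice_topE. Qed.

Definition disjunctive_witness (A B : closed_lattice) : closed_lattice :=
  xget \bot%O [set C | [/\ elt_set C !=set0, elt_set C `<=` elt_set A
                         & elt_set C `&` elt_set B = set0]].

Definition normal_witness (A B : closed_lattice) :
    closed_lattice * closed_lattice :=
  xget (\bot, \bot)%O [set PQ | [/\ elt_set PQ.1 `|` elt_set PQ.2 = setT,
    elt_set A `&` elt_set PQ.2 = set0 & elt_set B `&` elt_set PQ.1 = set0]].

(** Besides the lattice operations there are chosen witnesses of disjunctivity and normality, so
    that a countable family closed under all of these inherits both properties. *)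
Definition closed_lattice_op (k : nat) (s : seq (nat -> closed_lattice)) :
    nat -> closed_lattice :=
  fun n => let A := nth (fun=> \bot%O) s 0 n in
    let B := nth (fun=> \bot%O) s 1 n in
    match k with
    | 0 => \bot%O
    | 1 => \top%O
    | 2 => (A `&` B)%O
    | 3 => (A `|` B)%O
    | 4 => disjunctive_witness A B
    | 5 => (normal_witness A B).1
    | _ => (normal_witness A B).2
    end.

Hypotheses (cX : compact [set: X]) (hX : hausdorff_space X).

Lemma disjunctive_witnessP (A B : closed_lattice) :
  ~ elt_set A `<=` elt_set B ->
  [/\ elt_set (disjunctive_witness A B) !=set0,
      elt_set (disjunctive_witness A B) `<=` elt_set A
    & elt_set (disjunctive_witness A B) `&` elt_set B = set0].
Proof.
move=> /existsNP[x /not_implyP[Ax Bx]]; rewrite /disjunctive_witness.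
case: xgetP => [C _ []//|].
have c1 : closed [set x] by exact/accessible_closed_set1/hausdorff_accessible.
move=> /(_ (closed_elt c1))[]; split; first by exists x.
  by move=> _ ->.
by rewrite -subset0 => _ [-> /Bx].
Qed.

Lemma normal_witnessP (A B : closed_lattice) :
  elt_set A `&` elt_set B = set0 ->
  [/\ elt_set (normal_witness A B).1 `|` elt_set (normal_witness A B).2 = setT,
      elt_set A `&` elt_set (normal_witness A B).2 = set0
    & elt_set B `&` elt_set (normal_witness A B).1 = set0].
Proof.
move=> AB; rewrite /normal_witness; case: xgetP => [PQ _ []//|].
have cA := @elt_set_closed A; have cB := @elt_set_closed B.
(* [V] is a neighbourhood of [A] with closure off [B]; the closure of [V] and the complement of its
   interior are the required pair. *)
have [|V AV VB] := @compact_normal _ hX cX (elt_set A) cA (~` elt_set B).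
  move=> x Ax; apply: open_nbhs_nbhs; split; first by rewrite openC.
  by move=> Bx; have : (elt_set A `&` elt_set B) x by []; rewrite AB.
have cV : closed (~` V°) by rewrite closedC; exact: open_interior.
move=> /(_ (closed_elt (@closed_closure _ V), closed_elt cV))[]; split => /=.
- rewrite -subTset => x _; have [|nV] := pselect (V° x); last by right.
  by left; apply: subset_closure; exact: interior_subset.
- by apply/disjoints_subset; rewrite setCK.
- by rewrite setIC; apply/disjoints_subset.
Qed.

End ClosedLattice.

Section Hull.
Context (X : topologicalType) (gen : nat -> nat -> closed_lattice X).
Local Notation M := (closed_lattice X).
Hypotheses (cX : compact [set: X]) (hX : hausdorff_space X).

Definition closed_hull : set (nat -> M) :=
  skolem_hull gen (@closed_lattice_op X).

Lemma closed_hull_op k A B : closed_hull A -> closed_hull B ->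
  closed_hull (closed_lattice_op k [:: A; B]).
Proof.
by move=> LA LB; apply: skolem_hull_op => C; rewrite !inE => /orP[]/eqP->.
Qed.

Lemma closed_hull0 : closed_hull (fun=> \bot%O).
Proof. by have := @skolem_hull_op _ _ gen (@closed_lattice_op X) 0 [::]; apply. Qed.

Lemma closed_hullT : closed_hull (fun=> \top%O).
Proof. by have := @skolem_hull_op _ _ gen (@closed_lattice_op X) 1 [::]; apply. Qed.

Lemma closed_hullI A B : closed_hull A -> closed_hull B ->
  closed_hull (fun n => A n `&` B n)%O.
Proof. exact: (closed_hull_op 2). Qed.

Lemma closed_hullU A B : closed_hull A -> closed_hull B ->
  closed_hull (fun n => A n `|` B n)%O.
Proof. exact: (closed_hull_op 3). Qed.

Section Base.
Hypothesis gen_sep : forall F x, closed F -> ~ F x ->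
  exists k, F `<=` elt_set (gen k 0%N) /\ ~ elt_set (gen k 0%N) x.

(** Reading sequences at index [0] amounts to using the principal ultrafilter there, whose
    ultrapower is the lattice of closed sets itself. *)
Definition hull_sets : set (set X) := [set elt_set (A 0%N) | A in closed_hull].

Definition hull_base : closed_base X.
Proof.
exists hull_sets.
- by move=> _ [A _ <-]; exact: elt_set_closed.
- move=> F cF; exists [set A | hull_sets A /\ F `<=` A]; first by move=> A [].
  apply/seteqP; split=> [x Fx A [_]|x xF]; first exact.
  apply: contrapT => /(gen_sep cF)[k [Fk kx]]; apply: kx; apply: xF; split => //.
  by exists (gen k) => //; exact: skolem_hull_gen.
- by exists (fun=> \bot%O); [exact: closed_hull0|rewrite elt_set0].
- by exists (fun=> \top%O); [exact: closed_hullT|rewrite elt_setT].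
- move=> _ _ [A LA <-] [B LB <-]; exists (fun n => A n `|` B n)%O.
    exact: closed_hullU.
  by rewrite elt_setU.
- move=> _ _ [A LA <-] [B LB <-]; exists (fun n => A n `&` B n)%O.
    exact: closed_hullI.
  by rewrite elt_setI.
Defined.

Lemma countable_hull_base : countable (base_sets hull_base).
Proof. exact: sub_countable (card_image_le _ _) (countable_skolem_hull _ _). Qed.

(** The downward theorem of Loewenheim and Skolem, as the case of a principal ultrafilter in
    [los_elementarily_equivalent]. *)
Lemma hull_base_equivalent :
  elementarily_equivalent_lattices (closed_lattice X) (base_lattice hull_base).
Proof.
pose h (A : nat -> M) : base_lattice hull_base := insubd \bot%O (elt_set (A 0%N)).
have hE A : closed_hull A -> val (h A) = elt_set (A 0%N).
  by move=> LA; rewrite /h insubdK// inE; exists A.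
have hull_meet A B : closed_hull A -> closed_hull B ->
    val (h (fun n => A n `&` B n)%O) = val (h A `&` h B)%O.
  move=> LA LB; rewrite base_lattice_meetE hE; last exact: closed_hullI.
  by rewrite !hE// elt_setI.
have hull_join A B : closed_hull A -> closed_hull B ->
    val (h (fun n => A n `|` B n)%O) = val (h A `|` h B)%O.
  move=> LA LB; rewrite base_lattice_joinE hE; last exact: closed_hullU.
  by rewrite !hE// elt_setU.
apply: (@los_elementarily_equivalent _ _ (principal_filter 0%N)
  (principal_filter_ultra 0%N) _ _ closed_hull h).
- exact: closed_hull0.
- exact: closed_hullT.
- exact: closed_hullI.
- exact: closed_hullU.
- apply: val_inj; rewrite hE; last exact: closed_hull0.
  by rewrite elt_set0 base_lattice_botE.
- apply: val_inj; rewrite hE; last exact: closed_hullT.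
  by rewrite elt_setT base_lattice_topE.
- by move=> A B LA LB; apply: val_inj; exact: hull_meet.
- by move=> A B LA LB; apply: val_inj; exact: hull_join.
- move=> A B LA LB; split=> [AB|/principal_filterP AB].
    apply/principal_filterP; apply: elt_set_inj; move/(congr1 val) : AB.
    by rewrite !hE.
  by apply: val_inj; rewrite !hE//= AB.
- move=> b; have : hull_sets (val b) by have := valP b; rewrite inE.
  by move=> [A LA Ab]; exists A => //; apply: val_inj; rewrite hE.
- exact: skolem_hull_witness.
Qed.

End Base.

Section Ultracopower.
Context (U : set_system nat) {UU : UltraFilter U} (x0 : X).

(* The closed subset of the ultracopower given by [A]; points are not identified
   modulo [U], so it appears as a saturated set of representing sequences. *)
Definition ultra_set (A : nat -> M) : set (nat -> X) :=
  [set x | \forall n \near U, elt_set (A n) (x n)].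

Lemma ultra_choice (P : nat -> X -> Prop) :
  (\forall n \near U, exists x, P n x) ->
  exists x : nat -> X, \forall n \near U, P n (x n).
Proof.
move=> UP; have /choice[x xP] : forall n, exists x, (exists y, P n y) -> P n x.
  move=> n; have [[y Py]|nP] := pselect (exists y, P n y); first by exists y.
  by exists x0.
by exists x; apply: filterS UP => n; exact: xP.
Qed.

(** If the inclusion fails at almost every index, a choice of points there gives a sequence in the
    first set and outside the second. *)
Lemma ultra_set_sub A B : ultra_set A `<=` ultra_set B <->
  \forall n \near U, elt_set (A n) `<=` elt_set (B n).
Proof.
split=> [AB|AB x]; last by apply: filterS2 AB => n; exact.
apply: contrapT => nn; have nAB := (@ultra_near_not U UU _).1 nn.
have [x xAB] : exists x : nat -> X,
    \forall n \near U, elt_set (A n) (x n) /\ ~ elt_set (B n) (x n).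
  apply: (@ultra_choice (fun n y => elt_set (A n) y /\ ~ elt_set (B n) y)).
  apply: filterS nAB => n.
  by move=> /existsNP[x /not_implyP]; exists x.
have /AB : ultra_set A x by apply: filterS xAB => n [].
by move=> Bx; have [n [[_ nB] /nB]] := filter_ex (filterI xAB Bx).
Qed.

Lemma ultra_setI A B :
  ultra_set (fun n => A n `&` B n)%O = ultra_set A `&` ultra_set B.
Proof.
apply/seteqP; split=> [x xAB|x [xA xB]].
  by split; apply: filterS xAB => n; rewrite elt_setI => -[].
by apply: filterS2 xA xB => n xA xB; rewrite elt_setI.
Qed.

Lemma ultra_setU A B :
  ultra_set (fun n => A n `|` B n)%O = ultra_set A `|` ultra_set B.
Proof.
apply/seteqP; split=> x.
  move=> xAB; apply/ultra_near_or; apply: filterS xAB => n.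
  by rewrite elt_setU.
by move=> [xA|xB]; [apply: filterS xA|apply: filterS xB] => n ?;
  rewrite elt_setU; [left|right].
Qed.

Lemma ultra_set0 : ultra_set (fun=> \bot%O) = set0.
Proof. by rewrite -subset0 => x /filter_ex[n]; rewrite elt_set0. Qed.

Lemma ultra_setT : ultra_set (fun=> \top%O) = setT.
Proof. by rewrite -subTset => x _; apply: nearW => n; rewrite elt_setT. Qed.

Lemma ultra_set_eq A B : ultra_set A = ultra_set B <->
  \forall n \near U, A n = B n.
Proof.
split=> [AB|AB].
  have AB1 : ultra_set A `<=` ultra_set B by rewrite AB.
  have AB2 : ultra_set B `<=` ultra_set A by rewrite AB.
  move/ultra_set_sub : AB1; move/ultra_set_sub : AB2; apply: filterS2 => n.
  by move=> BA AB'; apply: elt_set_inj; apply/seteqP.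
by apply/seteqP; split; apply/ultra_set_sub; apply: filterS AB => n ->.
Qed.

Lemma ultra_set_disjoint A B : ultra_set A `&` ultra_set B = set0 ->
  \forall n \near U, elt_set (A n) `&` elt_set (B n) = set0.
Proof.
rewrite -ultra_setI -ultra_set0 => /ultra_set_eq; apply: filterS => n AB.
by rewrite -elt_setI AB elt_set0.
Qed.

Lemma disjoint_ultra_set A B :
  (\forall n \near U, elt_set (A n) `&` elt_set (B n) = set0) ->
  ultra_set A `&` ultra_set B = set0.
Proof.
move=> AB; rewrite -ultra_setI -ultra_set0; apply/ultra_set_eq.
by apply: filterS AB => n AB; apply: elt_set_inj; rewrite elt_setI AB elt_set0.
Qed.

Definition ultra_lattice : normal_set_lattice (nat -> X).
Proof.
exists [set ultra_set A | A in closed_hull].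
- by exists (fun=> \bot%O); [exact: closed_hull0|exact: ultra_set0].
- by exists (fun=> \top%O); [exact: closed_hullT|exact: ultra_setT].
- move=> _ _ [A LA <-] [B LB <-]; exists (fun n => A n `|` B n)%O.
    exact: closed_hullU.
  exact: ultra_setU.
- move=> _ _ [A LA <-] [B LB <-]; exists (fun n => A n `&` B n)%O.
    exact: closed_hullI.
  exact: ultra_setI.
- move=> _ _ [A LA <-] [B LB <-] /ultra_set_disjoint AB.
  pose P n := (normal_witness (A n) (B n)).1.
  pose Q n := (normal_witness (A n) (B n)).2.
  exists (ultra_set P), (ultra_set Q); split.
  + by exists P => //; exact: (closed_hull_op 5 LA LB).
  + by exists Q => //; exact: (closed_hull_op 6 LA LB).
  + rewrite -ultra_setU -ultra_setT; apply/ultra_set_eq; apply: filterS AB => n.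
    move=> /(normal_witnessP cX hX)[PQ _ _].
    by apply: elt_set_inj; rewrite elt_setU PQ elt_setT.
  + apply: disjoint_ultra_set; apply: filterS AB => n.
    by move=> /(normal_witnessP cX hX)[].
  + apply: disjoint_ultra_set; apply: filterS AB => n.
    by move=> /(normal_witnessP cX hX)[].
- move=> _ _ [A LA <-] [B LB <-] nAB.
  have {}nAB : \forall n \near U, ~ elt_set (A n) `<=` elt_set (B n).
    by apply/ultra_near_not => /ultra_set_sub.
  pose C n := disjunctive_witness (A n) (B n).
  exists (ultra_set C); split.
  + by exists C => //; exact: (closed_hull_op 4 LA LB).
  + have [|x xC] := @ultra_choice (fun n => elt_set (C n)); last by exists x.
    by apply: filterS nAB => n /(disjunctive_witnessP hX)[].
  + apply/ultra_set_sub; apply: filterS nAB => n.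
    by move=> /(disjunctive_witnessP hX)[].
  + apply: disjoint_ultra_set; apply: filterS nAB => n.
    by move=> /(disjunctive_witnessP hX)[].
Defined.

Lemma countable_ultra_lattice : countable (nsl_sets ultra_lattice).
Proof. exact: sub_countable (card_image_le _ _) (countable_skolem_hull _ _). Qed.

(** At almost every index two closed sets partition the connected space [X], so that one is empty;
    the ultrafilter decides which one. *)
Lemma ultra_lattice_connected : connected [set: X] ->
  forall A B, nsl_sets ultra_lattice A -> nsl_sets ultra_lattice B ->
  A `|` B = setT -> A `&` B = set0 -> A = set0 \/ B = set0.
Proof.
move=> conX _ _ [A LA <-] [B LB <-].
rewrite -ultra_setU -ultra_setT => /ultra_set_eq AB /ultra_set_disjoint AB0.
have : \forall n \near U, A n = \bot%O \/ B n = \bot%O.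
  apply: filterS2 AB AB0 => n /(congr1 (@elt_set X)).
  rewrite elt_setU elt_setT => AB AB0.
  have [A0|/set0P A0] := eqVneq (elt_set (A n)) set0.
    by left; apply: elt_set_inj; rewrite elt_set0.
  right; apply: elt_set_inj; rewrite elt_set0.
  have AE : elt_set (A n) = ~` elt_set (B n).
    apply/seteqP; split; first exact/disjoints_subset.
    by move=> x Bx; have : setT x by []; rewrite -AB => -[].
  have : elt_set (A n) = setT.
    apply: conX => //.
      exists (~` elt_set (B n)); last by rewrite setTI.
      by rewrite openC; exact: elt_set_closed.
    by exists (elt_set (A n)); [exact: elt_set_closed|rewrite setTI].
  by rewrite AE => /(congr1 setC); rewrite setCK setCT.
by move=> /ultra_near_or[] E; [left|right]; rewrite -ultra_set0; apply/ultra_set_eq.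
Qed.

(** Two sequences of the hull have the same basic closed set exactly if they agree modulo [U], so
    that the base realises the hull in the ultrapower. *)
Lemma wallman_base_equivalent : elementarily_equivalent_lattices
  (closed_lattice X) (base_lattice (wallman_base ultra_lattice)).
Proof.
pose B := wallman_base ultra_lattice.
pose w A := wallman_set ultra_lattice (ultra_set A).
pose h (A : nat -> M) : base_lattice B := insubd \bot%O (w A).
have LL A : closed_hull A -> nsl_sets ultra_lattice (ultra_set A) by exists A.
have hE A : closed_hull A -> val (h A) = w A.
  by move=> LA; rewrite /h insubdK// inE; exists (ultra_set A) => //; exact: LL.
have h_meet C D : closed_hull C -> closed_hull D ->
    val (h (fun n => C n `&` D n)%O) = val (h C `&` h D)%O.
  move=> LC LD; rewrite base_lattice_meetE hE; last exact: closed_hullI.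
  by rewrite !hE// /w ultra_setI wallman_setI//; exact: LL.
have h_join C D : closed_hull C -> closed_hull D ->
    val (h (fun n => C n `|` D n)%O) = val (h C `|` h D)%O.
  move=> LC LD; rewrite base_lattice_joinE hE; last exact: closed_hullU.
  by rewrite !hE// /w ultra_setU wallman_setU//; exact: LL.
apply: (@los_elementarily_equivalent _ _ U UU _ _ closed_hull h).
- exact: closed_hull0.
- exact: closed_hullT.
- exact: closed_hullI.
- exact: closed_hullU.
- apply: val_inj; rewrite hE; last exact: closed_hull0.
  by rewrite /w ultra_set0 wallman_set0 base_lattice_botE.
- apply: val_inj; rewrite hE; last exact: closed_hullT.
  by rewrite /w ultra_setT wallman_setT base_lattice_topE.
- by move=> C D LC LD; apply: val_inj; exact: h_meet.
- by move=> C D LC LD; apply: val_inj; exact: h_join.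
- move=> C D LC LD; split=> [/(congr1 val)|CD].
    rewrite !hE// => /wallman_set_inj CD; apply/ultra_set_eq.
    by apply: CD; exact: LL.
  by apply: val_inj; rewrite !hE// /w (ultra_set_eq C D).2.
- move=> b; have : @wallman_sets _ ultra_lattice (val b) by have := valP b; rewrite inE.
  by move=> [_ [A LA <-] Ab]; exists A => //; apply: val_inj; rewrite hE.
- exact: skolem_hull_witness.
Qed.

End Ultracopower.
End Hull.

(** * Spirals *)

Section Spirals.
Context (R : realType).
Implicit Types (a b r c s : R).
Local Open Scope ring_scope.

(** For [0 <= a <= 1] the positive swings of [t sin t] are damped by the factor [a], and the
    negative ones are kept. *)
Definition sweep a t : R := Num.min (a * (t * sin t)) (t * sin t).

(* [r = 1 / (1 + t)], and [(c, s)] is the point of the unit circle at angle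
   [sweep a t]; the limit circle is [r = 0]. *)
Definition on_spiral a r c s : Prop :=
  0 <= r <= 1 /\
  (0 < r -> c = cos (sweep a (r^-1 - 1)) /\ s = sin (sweep a (r^-1 - 1))).

(** On a connected domain, reaching both the outer end [r = 1] and the limit circle [r = 0] forces
    the whole ray to be covered. *)
Record spiral_map a (X : topologicalType) (r c s : X -> R) : Prop := SpiralMap {
  spiral_continuous1 : continuous r;
  spiral_continuous2 : continuous c;
  spiral_continuous3 : continuous s;
  spiral_on : forall x, on_spiral a (r x) (c x) (s x);
  spiral_start : exists x, r x = 1;
  spiral_end : exists x, r x = 0
}.

Lemma sweep_continuous a : continuous (sweep a).
Proof.
have ct : continuous (fun t : R => t * sin t).
  by move=> t; apply: cvgM; [exact: cvg_id|exact: continuous_sin].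
apply: (@min_fun_continuous _ R R (fun t => a * (t * sin t)) _ _ ct) => t.
by apply: cvgM; [exact: cvg_cst|exact: ct].
Qed.

Lemma sweep_angle_continuous a r : 0 < r ->
  {for r, continuous (fun r => sweep a (r^-1 - 1))}.
Proof.
move=> r0; apply: (@continuous_comp _ _ _ (fun r : R => r^-1 - 1) (sweep a)).
  apply: cvgB; last exact: cvg_cst.
  by apply: cvgV; [rewrite gt_eqF|exact: cvg_id].
exact: sweep_continuous.
Qed.

(** The relation is closed: the angle depends continuously on a positive radius, and at radius [0]
    it is free. *)
Lemma on_spiral_cvg a (T : Type) (F : set_system T) (r c s : T -> R) r0 c0 s0 :
  ProperFilter F -> (forall x, on_spiral a (r x) (c x) (s x)) ->
  r x @[x --> F] --> r0 -> c x @[x --> F] --> c0 -> s x @[x --> F] --> s0 ->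
  on_spiral a r0 c0 s0.
Proof.
move=> FF rcs Fr Fc Fs; have FF' : Filter F by typeclasses eauto.
split=> [|r00].
  have cr : cvg (r x @[x --> F]) by apply/cvg_ex; exists r0.
  rewrite -(cvg_lim _ Fr)//; apply/andP; split.
    by apply: limr_ge => //; apply: nearW => x; have [/andP[]] := rcs x.
  by apply: limr_le => //; apply: nearW => x; have [/andP[]] := rcs x.
have rpos : \forall x \near F, 0 < r x.
  by apply: (cvgr_gt r0 Fr).
have Fsw : sweep a ((r x)^-1 - 1) @[x --> F] --> sweep a (r0^-1 - 1).
  exact: (@continuous_cvg _ _ _ F FF' r (fun r => sweep a (r^-1 - 1)) r0
    (@sweep_angle_continuous a r0 r00) Fr).
split.
  have Fcos := @continuous_cvg _ _ _ F FF' _ _ _ (@continuous_cos R _) Fsw.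
  have E : {near F, cos \o (fun x => sweep a ((r x)^-1 - 1)) =1 c}.
    by apply: filterS rpos => x rx; have [_ /(_ rx)[->]] := rcs x.
  rewrite -(cvg_lim _ Fc)//; apply: cvg_lim => //.
  exact: (cvg_trans (near_eq_cvg E) Fcos).
have Fsin := @continuous_cvg _ _ _ F FF' _ _ _ (@continuous_sin R _) Fsw.
have E : {near F, sin \o (fun x => sweep a ((r x)^-1 - 1)) =1 s}.
  by apply: filterS rpos => x rx; have [_ /(_ rx)[_ ->]] := rcs x.
rewrite -(cvg_lim _ Fs)//; apply: cvg_lim => //.
exact: (cvg_trans (near_eq_cvg E) Fsin).
Qed.

Lemma sweep_le a t : 0 <= a -> 0 <= t -> sweep a t <= a * t.
Proof.
move=> a0 t0; rewrite /sweep ge_min; apply/orP; left.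
by apply: ler_wpM2l => //; rewrite ler_piMr// sin_le1.
Qed.

Lemma sweep_ge a t : 0 <= a <= 1 -> 0 <= t -> - t <= sweep a t.
Proof.
move=> /andP[a0 a1] t0; have u : - t <= t * sin t.
  by rewrite -[leLHS]mulrN1; apply: ler_wpM2l => //; exact: sin_geN1.
rewrite /sweep le_min u andbT.
have [u0|u0] := leP 0 (t * sin t).
  by apply: le_trans (mulr_ge0 a0 u0); rewrite oppr_le0.
by apply: le_trans u _; rewrite -[leLHS]mul1r ler_wnM2r// ltW.
Qed.

Lemma pihalf_periods_ge0 (k : nat) : 0 <= pi / 2 + (pi *+ 2) *+ k :> R.
Proof.
apply: addr_ge0; first by apply: divr_ge0; rewrite ?pi_ge0.
by do 2 apply: mulrn_wge0; exact: pi_ge0.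
Qed.

Lemma sweep_pihalf a (k : nat) : a <= 1 ->
  sweep a (pi / 2 + (pi *+ 2) *+ k) = a * (pi / 2 + (pi *+ 2) *+ k).
Proof.
move=> a1; rewrite /sweep (periodicn (@sinD2pi R)) sin_pihalf mulr1.
by apply/min_idPl; rewrite ler_piMl// pihalf_periods_ge0.
Qed.

Lemma sweep_3pihalf a (k : nat) : a <= 1 ->
  sweep a (pi / 2 + (pi *+ 2) *+ k + pi) = - (pi / 2 + (pi *+ 2) *+ k + pi).
Proof.
move=> a1; rewrite /sweep sinDpi (periodicn (@sinD2pi R)) sin_pihalf mulrN1.
apply/min_idPr; rewrite mulrN lerN2 ler_piMl//.
by rewrite addr_ge0 ?pi_ge0 ?pihalf_periods_ge0.
Qed.

Lemma cos_pihalf_norm a : `|a| = pi / 2 -> cos a = 0.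
Proof.
by case: (ger0P a) => _ aE; [rewrite aE|rewrite -cosN aE]; exact: cos_pihalf.
Qed.


Lemma on_spiral_angle a r c s (x := sweep a (r^-1 - 1)) :
  on_spiral a r c s -> 0 < r -> c = cos x /\ s = sin x.
Proof. by move=> [_]; apply. Qed.

(* The pieces of two spirals that are followed in parallel by the two maps form
   a clopen set: the total angles cannot drift apart continuously, as their
   difference stays away from [pi / 2], and neither map can go beyond the
   parameters [t] and [t + pi], where the sweep is a new maximum for [a], which
   is out of reach for [b], and a new minimum for [b]. *)
Lemma close_spiral_maps_eq (X : topologicalType) a b
    (r c s r' c' s' : X -> R) : connected [set: X] ->
  0 < b -> b < a -> a <= 1 ->
  spiral_map a r c s -> spiral_map b r' c' s' ->
  ~ forall x, [/\ `|r x - r' x| < 1 / 2, `|c x - c' x| < 1 / 2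
                & `|s x - s' x| < 1 / 2].
Proof.
move=> conX b0 ba a1 Sa Sb close.
have a0 : 0 < a := lt_trans b0 ba.
have b1 : b <= 1 := ltW (lt_le_trans ba a1).
have pi0 : 0 < pi :> R := pi_gt0 R.
(* With this [k] the gain [(a - b) t] exceeds the loss [b pi] by at least [2]; [t] is a peak of the
   sine and [t'] the next trough. *)
have [k kP] : exists k : nat, (b * pi + 2) / (a - b) <= k%:R.
  by eexists; exact: ltW (truncnS_gt _).
pose t : R := pi / 2 + (pi *+ 2) *+ k.
pose t' := t + pi.
have t1 : 1 <= t.
  rewrite /t -[leLHS]addr0; apply: lerD; first exact: pihalf_ge1.
  by do 2 apply: mulrn_wge0; exact: pi_ge0.
have kt : k%:R <= t.
  rewrite /t -[X in X <= _]add0r lerD//; first by rewrite divr_ge0// ltW.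
  rewrite -[leRHS]mulr_natl ler_peMr// mulr2n.
  by have := pi_ge2 R; lra.
have gap : b * t' + 2 <= a * t.
  have : b * pi + 2 <= t * (a - b).
    rewrite -ler_pdivrMr ?subr_gt0//; exact: le_trans kt.
  by rewrite /t'; lra.
pose rho := (1 + t)^-1; pose rho' := (1 + t')^-1.
have rho'0 : 0 < rho' by rewrite invr_gt0 /t'; lra.
have rho0 : 0 < rho by rewrite invr_gt0; lra.
have rho'lt : rho' <= rho by rewrite lef_pV2 ?posrE /t'; lra.
(* Cutting the radius off at [rho'] makes the angle continuous on all of [X] without changing it on
   [V]. *)
pose g (e : R) (f : X -> R) x := sweep e ((Num.max (f x) rho')^-1 - 1).
have g_continuous e (f : X -> R) : continuous f -> continuous (g e f).
  move=> cf x; apply: (@continuous_comp _ _ _ (fun x => Num.max (f x) rho')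
    (fun r => sweep e (r^-1 - 1))).
    by apply: (@max_fun_continuous _ X R f (cst rho')) => //; exact: cst_continuous.
  by apply: sweep_angle_continuous; rewrite lt_max rho'0 orbT.
pose F x := g a r x - g b r' x.
have F_continuous : continuous (fun x => `|F x|).
  move=> x; apply: cvg_norm; apply: cvgB; apply: g_continuous.
    exact: spiral_continuous1 Sa.
  exact: spiral_continuous1 Sb.
have r_continuous := spiral_continuous1 Sa.
have r'_continuous := spiral_continuous1 Sb.
pose V := [set x | [/\ rho < r x, rho' < r' x & `|F x| < pi / 2]].
have oV : open V.
  have -> : V = r @^-1` [set y | y > rho] `&` r' @^-1` [set y | y > rho']
      `&` (fun x => `|F x|) @^-1` [set y | y < pi / 2].
    by apply/seteqP; split=> x [] // [].
  apply: openI; first apply: openI.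
  - by move/continuousP : r_continuous; apply; exact: open_gt.
  - by move/continuousP : r'_continuous; apply; exact: open_gt.
  - by move/continuousP : F_continuous; apply; exact: open_lt.
have VE : V = r @^-1` [set y | rho <= y] `&` r' @^-1` [set y | rho' <= y]
    `&` (fun x => `|F x|) @^-1` [set y | y <= pi / 2].
  apply/seteqP; split=> x.
    by move=> [/= ? ? ?]; split; first split; exact: ltW.
  move=> [[/= rx r'x] Fx].
  have Fx_eq : F x = sweep a ((r x)^-1 - 1) - sweep b ((r' x)^-1 - 1).
    by rewrite /F /g !max_l//; exact: le_trans rx.
  have rx0 : 0 < r x := lt_le_trans rho0 rx.
  have r'x0 : 0 < r' x := lt_le_trans rho'0 r'x.
  have [[/andP[_ rx1] _] [/andP[_ r'x1] _]] := (spiral_on Sa x, spiral_on Sb x).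
  have [cE sE] := on_spiral_angle (spiral_on Sa x) rx0.
  have [c'E s'E] := on_spiral_angle (spiral_on Sb x) r'x0.
  (* The cosine is [1 - ((c - c')^2 + (s - s')^2) / 2], and both squares are less than [1 / 4]. *)
  have cosF : 0 < cos (F x).
    rewrite Fx_eq cosB -cE -sE -c'E -s'E.
    have := cos2Dsin2 (sweep a ((r x)^-1 - 1)); rewrite -cE -sE => E1.
    have := cos2Dsin2 (sweep b ((r' x)^-1 - 1)); rewrite -c'E -s'E => E2.
    have [_ + +] := close x; rewrite !ltr_norml => /andP[? ?] /andP[? ?].
    nra.
  have tx0 : 0 <= (r x)^-1 - 1 by rewrite subr_ge0 invf_ge1.
  have t'x0 : 0 <= (r' x)^-1 - 1 by rewrite subr_ge0 invf_ge1.
  have tx : (r x)^-1 - 1 <= t.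
    by rewrite lerBlDl -[leRHS]invrK lef_pV2// ?posrE// invr_gt0.
  have t'x : (r' x)^-1 - 1 <= t'.
    by rewrite lerBlDl -[leRHS]invrK lef_pV2// ?posrE// invr_gt0.
  have ph2 := pihalf_lt2 R.
  move: Fx; rewrite ler_norml Fx_eq => /andP[F1 F2].
  have rhoK : rho^-1 - 1 = t by rewrite invrK addrC addKr.
  have rho'K : rho'^-1 - 1 = t' by rewrite invrK addrC addKr.
  split.
  (* At [r x = rho] the first angle is [a t] and the second at most [b t']: by [gap] they differ by
     [2], more than [pi / 2]. *)
  - rewrite lt_neqAle rx andbT; apply/eqP => rE; move: F2.
    rewrite -rE rhoK sweep_pihalf// -/t.
    have : sweep b ((r' x)^-1 - 1) <= b * t'.
      by apply: le_trans (sweep_le (ltW b0) t'x0) _; rewrite ler_pM2l.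
    lra.
  (* At [r' x = rho'] the second angle is [- t'] and the first at least [- t]: they differ by at
     least [pi]. *)
  - rewrite lt_neqAle r'x andbT; apply/eqP => rE; move: F2.
    rewrite -rE rho'K sweep_3pihalf// -/t -/t'.
    have : - ((r x)^-1 - 1) <= sweep a ((r x)^-1 - 1).
      by apply: sweep_ge => //; rewrite ltW.
    by rewrite /t'; lra.
  - rewrite lt_neqAle; apply/andP; split; last by rewrite Fx_eq ler_norml F1.
    by apply/eqP => /cos_pihalf_norm F0; rewrite F0 ltxx in cosF.
have cV : closed V.
  rewrite VE; apply: closedI; first apply: closedI.
  - by move/continuous_closedP : r_continuous; apply; exact: closed_ge.
  - by move/continuous_closedP : r'_continuous; apply; exact: closed_ge.
  - by move/continuous_closedP : F_continuous; apply; exact: closed_le.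
have [x rx1] := spiral_start Sa.
(* At the start of the first spiral its angle is [0], while closeness gives [r' x > 1 / 2], hence a
   parameter and an angle below [1] in size for the second. *)
have Vx : V x.
  have [+ _ _] := close x; rewrite rx1 ltr_norml => /andP[r'1 r'2].
  have r'x : 1 / 2 < r' x by lra.
  have rho'2 : rho' <= 1 / 2.
    rewrite div1r lef_pV2 ?posrE /t' //; last by lra.
    by have := pi_ge2 R; lra.
  have rho1 : rho < 1.
    rewrite invf_lt1; last by lra.
    by rewrite ltrDl; lra.
  have r'x0 : 0 < r' x by lra.
  have [/andP[_ r'x1] _] := spiral_on Sb x.
  have t'x0 : 0 <= (r' x)^-1 - 1 by rewrite subr_ge0 invf_ge1.
  have t'x1 : (r' x)^-1 - 1 < 1.
    rewrite ltrBlDr -[ltRHS]invrK ltf_pV2 ?posrE ?invr_gt0//.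
    by have -> : (1 + 1)^-1 = 1 / 2 :> R by rewrite div1r.
  split; [by rewrite rx1|exact: le_lt_trans rho'2 r'x|].
  rewrite /F /g rx1 !max_l//; last 2 first.
    exact: ltW (le_lt_trans rho'2 r'x).
    exact: le_trans rho'lt (ltW rho1).
  rewrite invr1 subrr {1}/sweep mul0r mulr0 minxx sub0r normrN.
  apply: (@lt_le_trans _ _ 1); last exact: pihalf_ge1.
  have sge := @sweep_ge b _ _ t'x0; rewrite (ltW b0) b1 in sge.
  have sle := sweep_le (ltW b0) t'x0.
  rewrite ltr_norml; apply/andP; split.
    by have := sge isT; lra.
  apply: le_lt_trans sle _; apply: le_lt_trans t'x1.
  by rewrite ler_piMl.
have VT : V = setT.
  apply: conX; first by exists x.
    by exists V => //; rewrite setTI.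
  by exists V => //; rewrite setTI.
have [y ry0] := spiral_end Sa.
have : V y by rewrite VT.
by move=> [+ _ _]; rewrite ry0; lra.
Qed.

End Spirals.

(** * Countably many codes for uncountably many spirals *)

Section Approximation.
Context (R : realType) (X : topologicalType) (B : closed_base X).
Hypotheses (cX : compact [set: X]) (cB : countable (base_sets B)).
Local Open Scope ring_scope.

(* A continuous function is determined up to [1 / 2] by finitely many pairs of a
   basic open set and a rational value approximated by the function on it. *)
Lemma continuous_code : exists code : (X -> R) -> nat,
  forall f g, continuous f -> continuous g -> code f = code g ->
  forall x, `|f x - g x| < 1 / 2.
Proof.
have [e eB] := countable_enum set0 cB.
pose approx (f : X -> R) (nq : nat * rat) :=
  base_sets B (e nq.1) /\
  forall x, ~ e nq.1 x -> `|f x - ratr nq.2| < 1 / 4.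
have /choice[l lP] : forall f : X -> R, exists l : seq (nat * rat),
    continuous f -> (forall nq, nq \in l -> approx f nq) /\
      forall x, exists2 nq, nq \in l & ~ e nq.1 x.
  move=> f; have [cf|ncf] := pselect (continuous f); last by exists [::].
  have [nq [Bn _]|x _|E EP cE] := @compact_cover_compact _ _ cX _ (approx f)
    (fun nq => ~` e nq.1).
  - by rewrite openC; exact: base_closed Bn.
  - have : f x - 1 / 4 < f x + 1 / 4 by lra.
    move=> /rat_in_itvoo[q]; rewrite in_itv/= => /andP[q1 q2].
    pose V := f @^-1` [set y | y < ratr q + 1 / 4] `&`
              f @^-1` [set y | y > ratr q - 1 / 4].
    have oV : open V.
      move/continuousP : cf => cf.
      by apply: openI; apply: cf; [exact: open_lt|exact: open_gt].
    have cV : closed (~` V) by rewrite closedC.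
    have [S SB VS] := base_generates B cV.
    have : ~ (~` V) x by apply; split => /=; lra.
    rewrite VS => /existsNP[P /not_implyP[SP Px]].
    have [n en] := eB P (SB P SP).
    exists (n, q); last by rewrite /= en.
    split; rewrite /= en; first exact: SB.
    move=> y yP; have : V y.
      apply: contrapT => Vy; apply: yP.
      by move: Vy; rewrite -[~ V y]/((~` V) y) VS; exact.
    by move=> [/= ? ?]; rewrite ltr_norml; apply/andP; split; lra.
  - exists E => _; split=> [nq /EP|x]; first by rewrite inE.
    by have [nq nqE nqx] := cE x I; exists nq.
(* Equal codes mean equal lists, so that one pair approximates both functions at [x], each within
   [1 / 4]. *)
exists (pickle \o l) => f g cf cg /= /(pcan_inj pickleK) lfg x.
have [fP /(_ x)[nq nql nx]] := lP f cf.
have [gP _] := lP g cg.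
have [_ /(_ x nx) fq] := fP _ nql.
rewrite lfg in nql; have [_ /(_ x nx)] := gP _ nql.
move: fq; rewrite !ltr_norml => /andP[? ?] /andP[? ?].
by apply/andP; split; lra.
Qed.

Lemma unit_interval_uncountable (code : R -> nat) :
  ~ {in `]0, 1[ &, injective code}.
Proof.
move=> ci; have : countable (`]0, 1[%classic : set R).
  apply/countable_injP; exists code => x y; rewrite !inE => x01 y01.
  exact: ci.
move/countable_lebesgue_measure0; rewrite lebesgue_measure_itv/= lte_fin ltr01.
by move=> /eqP; rewrite oppr0 addr0 eqe oner_eq0.
Qed.

(** The codes of the three coordinates would inject an interval into [nat], since equal codes make
    two spiral maps close. *)
Lemma no_spiral_family : connected [set: X] ->
  ~ forall a : R, 0 < a < 1 -> exists r c s : X -> R, spiral_map a r c s.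
Proof.
move=> conX fam; have [code codeP] := continuous_code.
have /choice[m mP] : forall a : R, exists m : (X -> R) * (X -> R) * (X -> R),
    0 < a < 1 -> spiral_map a m.1.1 m.1.2 m.2.
  move=> a; have [/fam[r [c [s S]]]|na] := pselect (0 < a < 1).
    by exists (r, c, s).
  by exists (cst 0, cst 0, cst 0).
pose k a := pickle (code (m a).1.1, code (m a).1.2, code (m a).2).
apply: (@unit_interval_uncountable k) => a b.
wlog ba : a b / b < a.
  move=> W a01 b01 kab; have [ab|ba|//] := ltgtP a b.
    by symmetry; exact: W.
  exact: W.
move=> a01 b01 kab; have := pcan_inj pickleK kab; case=> k1 k2 k3.
rewrite in_itv/= in a01; rewrite in_itv/= in b01.
have Sa := mP a a01; have Sb := mP b b01.
exfalso; move: a01 b01 => /andP[a0 a1] /andP[b0 b1].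
apply: (close_spiral_maps_eq conX b0 ba (ltW a1) Sa Sb) => y; split.
- by apply: codeP k1 y; [exact: spiral_continuous1 Sa|exact: spiral_continuous1 Sb].
- by apply: codeP k2 y; [exact: spiral_continuous2 Sa|exact: spiral_continuous2 Sb].
- by apply: codeP k3 y; [exact: spiral_continuous3 Sa|exact: spiral_continuous3 Sb].
Qed.

End Approximation.

(** * An elementarily equivalent continuum with a spiral map *)

Section SpiralCopy.
Context (R : realType) (X : topologicalType) (a : R).
Hypotheses (conX : continuum X) (mX : metrizable R X).
Hypothesis ndX : nondegenerate_space X.
Local Open Scope ring_scope.

(* The [n]-th map sends [x] to the point of the spiral of parameter [n * h x]: for
   [n] tending to infinity, a point with [h q > 0] tends to the limit circle. *)
Definition stretched_radius (h : X -> R) (n : nat) (x : X) : R :=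
  (1 + n%:R * h x)^-1.

(* The opposites are there because [lattice_separates] only deals with sublevel
   sets, while continuity needs the superlevel sets as well. *)
Definition spiral_coordinate (h : X -> R) (j n : nat) (x : X) : R :=
  let r := stretched_radius h n x in
  let c := cos (sweep a (r^-1 - 1)) in
  let s := sin (sweep a (r^-1 - 1)) in
  match j with
  | 0 => r | 1 => c | 2 => s | 3 => - r | 4 => - c | _ => - s
  end.

Lemma metrizable_height : exists h : X -> R, [/\ continuous h,
  forall x, 0 <= h x, exists p, h p = 0 & exists q, 0 < h q].
Proof.
have [d [d0 dE dC dT dN]] := mX; have [p [q pq]] := ndX.
exists (d p); split => //.
- move=> x; apply/cvgrPdist_lt => e e0; apply/dN; exists e => // y /= xy.
  apply: le_lt_trans xy; rewrite ler_norml; apply/andP; split.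
    by have := dT p x y; lra.
  by have := dT p y x; rewrite (dC y); lra.
- by exists p; exact/dE.
- by exists q; rewrite lt_neqAle d0 andbT eq_sym; apply/eqP => /dE.
Qed.

Section Coordinates.
Variable h : X -> R.
Hypotheses (h_continuous : continuous h) (h_ge0 : forall x, 0 <= h x).

Lemma stretched_radius_itv n x : 0 < stretched_radius h n x <= 1.
Proof.
have n0 : 0 <= n%:R * h x by rewrite mulr_ge0.
by rewrite /stretched_radius invr_gt0 invf_le1 ?ltr_pwDl// lerDl n0.
Qed.

Lemma stretched_radius_continuous n : continuous (stretched_radius h n).
Proof.
move=> x; have /andP[r0 _] := stretched_radius_itv n x.
apply: cvgV; first by rewrite -invr_eq0 gt_eqF.
apply: cvgD; first exact: cvg_cst.
by apply: cvgM; [exact: cvg_cst|exact: h_continuous].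
Qed.

Lemma spiral_coordinate_continuous j n : continuous (spiral_coordinate h j n).
Proof.
move=> x; have rc := @stretched_radius_continuous n x.
have /andP[r0 _] := stretched_radius_itv n x.
have ac : {for x, continuous
    (fun x => sweep a ((stretched_radius h n x)^-1 - 1))}.
  exact: (@continuous_comp _ _ _ (stretched_radius h n)
    (fun r => sweep a (r^-1 - 1)) x rc (@sweep_angle_continuous _ a _ r0)).
have cc := continuous_comp ac (@continuous_cos R _).
have sc := continuous_comp ac (@continuous_sin R _).
by case: j => [|[|[|[|[|j]]]]] //; apply: cvgN.
Qed.

Lemma spiral_coordinate_bounded j n x : `|spiral_coordinate h j n x| <= 1.
Proof.
have /andP[r0 r1] := stretched_radius_itv n x.
have cb y : `|cos y| <= 1 :> R by rewrite ler_norml cos_geN1 cos_le1.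
have sb y : `|sin y| <= 1 :> R by rewrite ler_norml sin_geN1 sin_le1.
by case: j => [|[|[|[|[|j]]]]]; rewrite /= ?normrN// gtr0_norm.
Qed.

Lemma spiral_coordinate_on n x : on_spiral a (spiral_coordinate h 0 n x)
  (spiral_coordinate h 1 n x) (spiral_coordinate h 2 n x).
Proof. by have /andP[r0 r1] := stretched_radius_itv n x; split=> //=; rewrite r1 ltW. Qed.

(** Rational sublevel sets of the coordinates of the [n]-th map, taken at index [n]: as generators
    of the hull they let the limit coordinates extend to the Wallman space. *)
Definition spiral_gen (k n : nat) : closed_lattice X :=
  if unpickle k is Some (j, q) then
    insubd \bot%O [set x | spiral_coordinate h j n x <= ratr q]
  else \bot%O.

Lemma spiral_genE j q n : elt_set (spiral_gen (pickle (j, q)) n) =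
  [set x | spiral_coordinate h j n x <= ratr q].
Proof.
rewrite /spiral_gen pickleK /elt_set -[sval _]/(val _) insubdK// inE.
have /continuous_closedP := @spiral_coordinate_continuous j n.
by move=> /(_ _ (@closed_le R (ratr q))).
Qed.

Context (U : set_system nat) {UU : UltraFilter U}.
Hypotheses (cX : compact [set: X]) (hX : hausdorff_space X).
Variable p : X.
Let L := @ultra_lattice X spiral_gen cX hX U UU p.

Definition ultra_coordinate (j : nat) (x : nat -> X) : R :=
  lim (spiral_coordinate h j n (x n) @[n --> U]).

Lemma ultra_coordinate_cvg j x :
  spiral_coordinate h j n (x n) @[n --> U] --> ultra_coordinate j x.
Proof.
apply: (@ultra_bounded_cvg R nat U _ 1) => n.
exact: spiral_coordinate_bounded.
Qed.

Lemma ultra_coordinate_bounded j : bounded1 (ultra_coordinate j).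
Proof.
move=> x; have H : `|spiral_coordinate h j n (x n)| @[n --> U] -->
    `|ultra_coordinate j x| by apply: cvg_norm; exact: ultra_coordinate_cvg.
rewrite -(cvg_lim _ H)//; apply: limr_le; first by apply/cvg_ex; eexists; exact: H.
by apply: nearW => n; exact: spiral_coordinate_bounded.
Qed.

Lemma ultra_coordinate_separates j : lattice_separates L (ultra_coordinate j).
Proof.
move=> b b' /rat_in_itvoo[q]; rewrite in_itv/= => /andP[bq qb'].
exists (ultra_set U (spiral_gen (pickle (j, q)))); split.
- by exists (spiral_gen (pickle (j, q))) => //; exact: skolem_hull_gen.
- move=> x xb.
  have xq : \forall n \near U, spiral_coordinate h j n (x n) < ratr q.
    apply: (cvgr_lt (ultra_coordinate j x)); first exact: ultra_coordinate_cvg.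
    exact: le_lt_trans bq.
  by apply: filterS xq => n xq; rewrite spiral_genE /= ltW.
- move=> x xq; apply: le_trans (ltW qb'); apply: limr_le.
    by apply/cvg_ex; eexists; exact: ultra_coordinate_cvg.
  by apply: filterS xq => n; rewrite spiral_genE.
Qed.

Lemma ultra_coordinateN j : (j < 3)%N ->
  \- ultra_coordinate j = ultra_coordinate (j + 3).
Proof.
move=> j3; apply/funext => x /=; symmetry; apply: cvg_lim => //.
have H : - spiral_coordinate h j n (x n) @[n --> U] --> - ultra_coordinate j x.
  by apply: cvgN; exact: ultra_coordinate_cvg.
by case: j j3 H => [|[|[|]]].
Qed.

Definition limit_coordinate (j : nat) : wallman L -> R :=
  wallman_extend (ultra_coordinate j).

Lemma limit_coordinate_continuous j : (j < 3)%N -> continuous (limit_coordinate j).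
Proof.
move=> j3; apply: wallman_extend_continuous.
- exact: ultra_coordinate_bounded.
- exact: ultra_coordinate_separates.
- by rewrite ultra_coordinateN//; exact: ultra_coordinate_separates.
Qed.

Lemma limit_coordinate_point j (x : nat -> X) (l : R) : (j < 3)%N ->
  spiral_coordinate h j n (x n) @[n --> U] --> l ->
  limit_coordinate j (wallman_point L x) = l.
Proof.
move=> j3 xl; rewrite /limit_coordinate wallman_extend_point.
- exact: cvg_lim.
- exact: ultra_coordinate_bounded.
- exact: ultra_coordinate_separates.
- by rewrite ultra_coordinateN//; exact: ultra_coordinate_separates.
Qed.

(** Lying on the spiral survives two limits, along [U] and along the ultrafilter of a Wallman point.
    The constant sequences [p] and [q] give the outer end and the limit circle. *)
Lemma limit_spiral_map (q : X) : \oo `<=` U -> h p = 0 -> 0 < h q ->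
  spiral_map a (limit_coordinate 0) (limit_coordinate 1) (limit_coordinate 2).
Proof.
move=> ooU hp hq; split; try exact: limit_coordinate_continuous.
- move=> y; have GU := wallman_ultraP y.
  apply: (@on_spiral_cvg _ a _ (wallman_ultra y)
    (ultra_coordinate 0) (ultra_coordinate 1) (ultra_coordinate 2)).
  + move=> x; apply: (@on_spiral_cvg _ a _ U _ _ _ _ _ _ _ _
      (@ultra_coordinate_cvg 0 x) (@ultra_coordinate_cvg 1 x)
      (@ultra_coordinate_cvg 2 x)).
    by move=> n; exact: spiral_coordinate_on.
  + by apply: wallman_extend_cvg; exact: ultra_coordinate_bounded.
  + by apply: wallman_extend_cvg; exact: ultra_coordinate_bounded.
  + by apply: wallman_extend_cvg; exact: ultra_coordinate_bounded.
- exists (wallman_point L (fun=> p)); apply: limit_coordinate_point => //=.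
  rewrite /stretched_radius hp.
  under eq_cvg do rewrite mulr0 addr0 invr1.
  exact: cvg_cst.
- exists (wallman_point L (fun=> q)); apply: limit_coordinate_point => //=.
  suff oo0 : stretched_radius h n q @[n --> \oo] --> (0 : R).
    by move=> V /oo0; exact: ooU.
  (* The radius at [q] lies between [0] and [1 / (n * h q)] for positive [n]. *)
  apply: (@squeeze_cvgr _ _ _ _ (cst 0) (fun n => (h q)^-1 * n%:R^-1)).
  + near=> n; have /andP[r0 _] := stretched_radius_itv n q.
    rewrite ltW//= /stretched_radius -invfM mulrC lef_pV2 ?posrE ?lerDr//.
      by rewrite ltr_pwDl// mulr_ge0.
    by rewrite mulr_gt0// ltr0n; near: n; exact: nbhs_infty_gt.
  + exact: cvg_cst.
  + rewrite -[X in _ --> X](mulr0 (h q)^-1); apply: cvgM; first exact: cvg_cst.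
    apply: ((gtr0_cvgV0 (f := fun n : nat => n%:R : R) _).2 cvgr_idn).
    by exists 1%N => // n /= n0; rewrite ltr0n.
Unshelve. all: end_near. Qed.

End Coordinates.

Lemma equivalent_spiral_continuum : exists (Y : topologicalType) (C : closed_base Y),
  [/\ metric_continuum R Y, countable (base_sets C),
      elementarily_equivalent_lattices (closed_lattice X) (base_lattice C)
    & exists r c s : Y -> R, spiral_map a r c s].
Proof.
have [h [hc h0 [p hp] [q hq]]] := metrizable_height.
have [U [UU ooU]] := ultraFilterLemma (eventually_filter : ProperFilter \oo).
have [X0 cX cnX hX] := conX.
pose L := @ultra_lattice X (spiral_gen h) cX hX U UU p.
have cB : countable (base_sets (wallman_base L)).
  by apply: countable_wallman_sets; exact: countable_ultra_lattice.
exists (wallman L), (wallman_base L); split => //.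
- split; [split|].
  + by exists (wallman_point L (fun=> p)).
  + exact: wallman_compact.
  + by apply: wallman_connected; exact: ultra_lattice_connected.
  + exact: wallman_hausdorff.
  + apply: (@countable_base_metrizable R _ (wallman_base L)) => //.
      exact: wallman_compact.
    exact: wallman_hausdorff.
- exact: wallman_base_equivalent.
- by do 3 eexists; exact: (limit_spiral_map hc h0 cX hX ooU hp hq).
Qed.

End SpiralCopy.

(** * Transfer along homeomorphisms and the failure of categoricity *)

Lemma homeomorphic_sym (X Y : topologicalType) :
  homeomorphic X Y -> homeomorphic Y X.
Proof. by move=> [f [g [fK gK cf cg]]]; exists g, f. Qed.

Lemma spiral_map_homeomorphic (R : realType) (a : R) (X Y : topologicalType)
    (r c s : Y -> R) : homeomorphic X Y -> spiral_map a r c s ->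
  exists r' c' s' : X -> R, spiral_map a r' c' s'.
Proof.
move=> [f [g [_ gK cf _]]] [rc cc sc on [x rx] [y ry]].
exists (r \o f), (c \o f), (s \o f); split.
- by move=> z; apply: continuous_comp; [exact: cf|exact: rc].
- by move=> z; apply: continuous_comp; [exact: cf|exact: cc].
- by move=> z; apply: continuous_comp; [exact: cf|exact: sc].
- by move=> z; exact: on.
- by exists (g x); rewrite /= gK.
- by exists (g y); rewrite /= gK.
Qed.

(** The hull of constant sequences that separate points from closed sets is a base at index [0]. *)
Lemma countable_base_equivalent (R : realType) (X : topologicalType) :
  compact [set: X] -> metrizable R X ->
  exists B : closed_base X, countable (base_sets B) /\
    elementarily_equivalent_lattices (closed_lattice X) (base_lattice B).
Proof.
move=> cX mX; have [gen [cgen gen_sep]] := metrizable_separating_sequence cX mX.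
pose g k (n : nat) := closed_elt (cgen k).
have g_sep F x : closed F -> ~ F x ->
    exists k, F `<=` elt_set (g k 0%N) /\ ~ elt_set (g k 0%N) x.
  exact: gen_sep.
exists (hull_base g_sep); split; first exact: countable_hull_base.
exact: hull_base_equivalent.
Qed.

Theorem mainTheorem1 (R : realType) (X : topologicalType) :
  metric_continuum R X -> nondegenerate_space X ->
  ~ categorical R X /\
  exists Y : topologicalType,
    [/\ metric_continuum R Y,
        exists (B : closed_base X) (C : closed_base Y),
          [/\ countable (base_sets B), countable (base_sets C) &
              elementarily_equivalent_lattices
                (base_lattice B) (base_lattice C)] &
        ~ homeomorphic X Y].
Proof.
move=> [conX mX] ndX; have [_ cX cnX _] := conX.
have [B [cB XB]] := countable_base_equivalent cX mX.
(* The lattice of all closed sets of [X] is the common term of comparison for the two countable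
   bases. *)
suff [Y [C [mY cC XC nh]]] : exists (Y : topologicalType) (C : closed_base Y),
    [/\ metric_continuum R Y, countable (base_sets C),
        elementarily_equivalent_lattices (closed_lattice X) (base_lattice C)
      & ~ homeomorphic X Y].
  have BC : elementarily_equivalent_lattices (base_lattice B) (base_lattice C).
    apply: elementarily_equivalent_lattices_trans XC.
    exact: elementarily_equivalent_lattices_sym.
  split; last by exists Y; split => //; exists B, C.
  have [[_ cY _ _] metY] := mY.
  move=> /(_ Y cY metY) catX; apply: nh; apply/homeomorphic_sym/catX.
  by exists B, C.
(* Were every such [Y] homeomorphic to [X], the spiral maps of the copies for all [a] would pull
   back to [X]. *)
apply: contrapT => nY; apply: (no_spiral_family cX cB cnX) => a _.
have [Y [C [mY cC XC [r [c [s S]]]]]] := equivalent_spiral_continuum a conX mX ndX.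
apply: spiral_map_homeomorphic S; apply: contrapT => nh.
by apply: nY; exists Y, C.
Qed.
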